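(* Let $\Delta$ be a $1$-dimensional flag simplicial complex on $[n]$, and let $p$ be an integer with $2\le p\le\nu(\overline\Delta)$. Then $$\beta_{1,2p+2}(I_\Delta^{[p]})=\sum_{\substack{0\le i\le p-1\\ i\text{ even}}}\Big|\big\{\text{induced subgraphs of }\Delta\text{ isomorphic to }K_{2+i,\,2p-i}\big\}\Big|.$$
   Context: A $1$-dimensional flag simplicial complex $\Delta$ on $[n]=\{1,\dots,n\}$ is a $1$-dimensional simplicial complex whose Stanley--Reisner ideal $I_\Delta$ is generated in degree two; equivalently, a triangle-free graph on the vertex set $[n]$ (with at least one edge, isolated vertices allowed). $\overline{\Delta}$ denotes the complement graph on $[n]$, so $I_\Delta=(x_ix_j:\{i,j\}\in E(\overline\Delta))$ is the edge ideal of $\overline\Delta$ in $S=K[x_1,\dots,x_n]$, where $K$ is an arbitrary field. $\nu(\overline\Delta)$ is the largest size of a matching (set of pairwise disjoint edges) of $\overline\Delta$. The squarefree power $I_\Delta^{[p]}$ is generated by the squarefree monomials among the minimal generators of $I_\Delta^p$, i.e. by the products of the variables indexed by the $2p$ vertices of the $p$-matchings of $\overline\Delta$. Graded Betti numbers $\beta_{i,j}(I)$ are those of the minimal graded free $S$-resolution of the ideal $I$ (so $\beta_{0,j}$ counts minimal generators). $K_{a,b}$ is the complete bipartite graph with parts of sizes $a,b$. The number of induced subgraphs isomorphic to $H$ is the number of vertex subsets $W\subseteq[n]$ with induced subgraph $\Delta_W\cong H$. *)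

(* Defs.v *)
From HB Require Import structures.
From mathcomp Require Import all_boot all_order all_algebra.
From mathcomp Require Import mpoly.

Set Implicit Arguments.
Unset Strict Implicit.
Unset Printing Implicit Defensive.

Import GRing.Theory.
Local Open Scope ring_scope.

Definition simplicial_complex n (D : {set {set 'I_n}}) : Prop :=
  set0 \in D /\ forall A B : {set 'I_n}, A \in D -> B \subset A -> B \in D.

Definition has_dim n (D : {set {set 'I_n}}) (d : nat) : Prop :=
  (exists2 A, A \in D & #|A| = d.+1) /\ (forall A, A \in D -> (#|A| <= d.+1)%N).

Definition adj n (D : {set {set 'I_n}}) : rel 'I_n :=
  fun u v => (u != v) && ([set u; v] \in D).

Definition compl_edges n (D : {set {set 'I_n}}) : {set {set 'I_n}} :=
  [set e : {set 'I_n} | (#|e| == 2%N) && (e \notin D)].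

Definition matching n (E M : {set {set 'I_n}}) : bool :=
  (M \subset E) && trivIset M.

Definition matching_number n (E : {set {set 'I_n}}) : nat :=
  \max_(M | matching E M) #|M|.

Definition complete_bipartite a b : rel ('I_a + 'I_b)%type :=
  fun x y => is_inl x != is_inl y.

Definition induced_iso n (D : {set {set 'I_n}}) (W : {set 'I_n})
    (V : finType) (e : rel V) : bool :=
  [exists f : {ffun V -> 'I_n},
    [&& injectiveb f, [set f x | x : V] == W
      & [forall x, forall y, e x y == adj D (f x) (f y)]]].

Definition nb_induced n (D : {set {set 'I_n}}) (V : finType) (e : rel V) : nat :=
  #|[set W : {set 'I_n} | induced_iso D W e]|.

Definition ideal_gen (R : comNzRingType) (G : R -> Prop) (f : R) : Prop :=
  exists (m : nat) (c g : 'I_m -> R),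
    (forall k, G (g k)) /\ f = \sum_k c k * g k.

Definition ideal_pow (R : comNzRingType) (I : R -> Prop) (p : nat) : R -> Prop :=
  ideal_gen (fun f => exists g : 'I_p -> R,
    (forall k, I (g k)) /\ f = \prod_k g k).

Definition generated_in_degree n (K : fieldType) (d : nat)
    (I : {mpoly K[n]} -> Prop) : Prop :=
  forall f, I f <-> ideal_gen (fun g => I g /\ g \is d.-homog) f.

Definition stanley_reisner n (K : fieldType) (D : {set {set 'I_n}}) :
    {mpoly K[n]} -> Prop :=
  ideal_gen (fun f => exists2 A : {set 'I_n}, A \notin D & f = \prod_(i in A) 'X_i).

Definition flag_complex n (K : fieldType) (D : {set {set 'I_n}}) : Prop :=
  simplicial_complex D /\ generated_in_degree 2 (@stanley_reisner n K D).

(** [m] is the exponent of an element of the minimal monomial generating set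
    of the monomial ideal [I]. *)
Definition min_monomial n (K : fieldType) (I : {mpoly K[n]} -> Prop)
    (m : 'X_{1..n}) : Prop :=
  I 'X_[m] /\ forall m' : 'X_{1..n}, (m' <= m)%MM -> I 'X_[m'] -> m' = m.

Definition squarefree_mnm n (m : 'X_{1..n}) : Prop := forall i, (m i <= 1)%N.

Definition squarefree_power n (K : fieldType) (I : {mpoly K[n]} -> Prop)
    (p : nat) : {mpoly K[n]} -> Prop :=
  ideal_gen (fun f => exists m : 'X_{1..n},
    [/\ min_monomial (ideal_pow I p) m, squarefree_mnm m & f = 'X_[m]]).

(** The module in homological degree [i] is the direct sum, over
    [k < fr_rank i], of the copies [S(- fr_shift k)] of [S = K[x_1..x_n]]; its
    elements are row vectors, on which the differentials act by right
    multiplication. *)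

Record free_complex n (K : fieldType) := FreeComplex {
  fr_rank : nat -> nat;
  fr_shift : forall i, 'I_(fr_rank i) -> nat;
  fr_aug : 'M[{mpoly K[n]}]_(fr_rank 0, 1);
  fr_diff : forall i, 'M[{mpoly K[n]}]_(fr_rank i.+1, fr_rank i)
}.

(** The maps have degree 0: a nonzero entry from [S(-b)] to [S(-a)] is
    homogeneous of degree [b - a]. *)
Definition graded_complex n (K : fieldType) (F : free_complex n K) : Prop :=
  (forall k m, m \in msupp (fr_aug F k 0) -> mdeg m = fr_shift k) /\
  (forall i k l m, m \in msupp (fr_diff F i k l) ->
     (mdeg m + fr_shift l)%N = fr_shift k).

Definition resolves n (K : fieldType) (F : free_complex n K)
    (I : {mpoly K[n]} -> Prop) : Prop :=
  [/\ forall f, I f <-> exists v : 'rV_(fr_rank F 0), (v *m fr_aug F) 0 0 = f,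
      forall v : 'rV_(fr_rank F 0),
        v *m fr_aug F = 0 <-> exists w, v = w *m fr_diff F 0
    & forall i (v : 'rV_(fr_rank F i.+1)),
        v *m fr_diff F i = 0 <-> exists w, v = w *m fr_diff F i.+1].

(** [fr_aug] is not constrained: its minimality says that the image of
    [fr_diff 0] lies in [(x_1, ..., x_n) F_0]. *)
Definition minimal_complex n (K : fieldType) (F : free_complex n K) : Prop :=
  forall i k l, (fr_diff F i k l)@_0%MM = 0.

Definition minimal_graded_free_resolution n (K : fieldType)
    (I : {mpoly K[n]} -> Prop) (F : free_complex n K) : Prop :=
  [/\ graded_complex F, resolves F I & minimal_complex F].

(** Graded Betti numbers: the multiplicity of [S(-j)] in homological degree [i]
    of a minimal resolution. The minimal graded free resolution of an ideal is
    unique up to isomorphism, so this does not depend on the choice of [F]. *)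
Definition graded_betti n (K : fieldType) (F : free_complex n K) (i j : nat) : nat :=
  #|[set k : 'I_(fr_rank F i) | fr_shift k == j]|.

(* Main.v *)
(** Let G be the complement graph and U range over the 2p-sets of vertices on
    which G has a perfect matching, so that the x^U generate the ideal; let P be
    the free module on the symbols e_U and Syz the kernel of e_U |-> x^U. Lifting
    between P and F shows that the Betti number is the dimension of
    Syz / (x_1, ..., x_n) Syz in degree 2p+2.

    In a multidegree w of degree 2p+2 this quotient has dimension one less than
    the number of components of the graph on the U dividing w in which U and U'
    are adjacent when |U u U'| <= 2p+1. If w is not squarefree, any two U are
    adjacent. If w = x^W, write U = W \ {u,v}. Since the complement of G is
    triangle-free, of three vertices two are adjacent in G. If some U = W \ {u,v}
    with u, v not adjacent in G occurs, then every vertex c of W other than u, v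
    has a partner d in the matching of U, d is adjacent to u or v, and exchanging
    gives a perfect matching of W \ {c,v} or W \ {c,u}: the graph is connected.
    Otherwise W has a perfect matching N, and blocks of N joined by an edge of G
    give connected U; so the graph is connected unless G restricted to W is the
    disjoint union of two even cliques, when there are two components, one for
    each clique containing {u,v}. These W are the induced complete bipartite
    subgraphs of the statement. *)

Require Import Defs.
From HB Require Import structures.
From mathcomp Require Import all_boot all_order all_algebra.
From mathcomp Require Import mpoly.
From mathcomp Require Import zify.

Set Implicit Arguments.
Unset Strict Implicit.
Unset Printing Implicit Defensive.

(** * Perfect matchings in graphs of independence number two *)

Section Matchings.
Variables (T : finType) (E : {set {set T}}).
Hypothesis E2 : forall e, e \in E -> #|e| = 2%N.

Definition perfect (U : {set T}) : bool :=
  [exists M : {set {set T}}, (M \subset E) && partition M U].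

Lemma perfectP (U : {set T}) :
  reflect (exists2 M : {set {set T}}, M \subset E & partition M U) (perfect U).
Proof.
by apply: (iffP existsP) => [[M /andP[]]|[M ME MU]]; exists M => //; apply/andP.
Qed.

Lemma edge_neq0 e : e \in E -> e != set0.
Proof. by move=> /E2; case: eqP => // ->; rewrite cards0. Qed.

Lemma perfect_addE (M : {set {set T}}) (U e : {set T}) :
    M \subset E -> partition M U -> e \in E -> [disjoint e & U] ->
  (e |: M \subset E) && partition (e |: M) (e :|: U).
Proof.
move=> ME MU eE dis; rewrite subUset sub1set eE ME /=.
by apply: partitionU1 => //; exact: edge_neq0.
Qed.

Lemma perfect0 : perfect set0.
Proof. by apply/perfectP; exists set0; rewrite ?sub0set ?partition_set0. Qed.

Lemma perfectU1 (e U : {set T}) : e \in E -> [disjoint e & U] -> perfect U -> perfect (e :|: U).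
Proof.
move=> eE dis /perfectP[M ME MU]; apply/perfectP; exists (e |: M);
by have /andP[] := perfect_addE ME MU eE dis.
Qed.

Lemma partner (M : {set {set T}}) U x :
    M \subset E -> partition M U -> x \in U ->
  exists c, [/\ [set x; c] \in M, c != x & c \in U].
Proof.
move=> ME MU xU; have := cover_partition MU => cM.
have /bigcupP[e eM xe] : x \in cover M by rewrite cM.
have /cards2P[a [b [ab eab]]] : #|e| == 2%N by rewrite E2 // (subsetP ME).
have sU := partitionS MU eM; move: xe sU eM; rewrite eab !inE subUset !sub1set.
case/orP=> /eqP -> /andP[aU bU] eM; first by exists b; split; rewrite // eq_sym.
by exists a; split; rewrite 1?setUC.
Qed.

Hypothesis alpha2 : forall a b c, a != b -> a != c -> b != c ->
  [|| [set a; b] \in E, [set a; c] \in E | [set b; c] \in E].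

Lemma perfect_even U : perfect U -> ~~ odd #|U|.
Proof.
case/perfectP=> M ME MU; rewrite (card_uniform_partition (n := 2) _ MU) ?oddM ?andbF //.
by move=> e eM; rewrite E2 // (subsetP ME).
Qed.

(** The graph on [W] is the disjoint union of two nonempty even cliques, [A] and [W :\: A]; evenness
    of the second follows from that of [A] and [W]. *)
Definition two_cliques (W A : {set T}) : bool :=
  [&& A \subset W, A != set0, W :\: A != set0, ~~ odd #|A|, ~~ odd #|W|
    & [forall u in W, forall v in W, (u != v) ==>
        (([set u; v] \in E) == ((u \in A) == (v \in A)))]].

Lemma two_cliquesP (W A : {set T}) : reflect
  ([/\ A \subset W, A != set0, W :\: A != set0, ~~ odd #|A| & ~~ odd #|W|]
   /\ forall u v, u \in W -> v \in W -> u != v ->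
        ([set u; v] \in E) = ((u \in A) == (v \in A)))
  (two_cliques W A).
Proof.
apply: (iffP and5P) => [[AW A0 B0 oA /andP[oW /forall_inP ed]]|[[AW A0 B0 oA oW] ed]].
  split=> // u v uW vW uv; have /forall_inP/(_ v vW) := ed u uW.
  by rewrite uv => /eqP.
split=> //; rewrite oW; apply/forall_inP => u uW; apply/forall_inP => v vW.
by apply/implyP => uv; rewrite ed.
Qed.

(** With [m] equal to 2p and W of size 2p+2, adjacency says that the lcm of x^U and x^U' has degree
    below 2p+2, so that their syzygy arises in a smaller degree. *)
Definition near m (W U U' : {set T}) :=
  [&& [&& U \subset W, #|U| == m & perfect U],
      [&& U' \subset W, #|U'| == m & perfect U'] & (#|U :|: U'| <= m.+1)%N].

Lemma near_sym m W U U' : near m W U U' = near m W U' U.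
Proof. by rewrite /near setUC andbCA. Qed.

Lemma nears_sym m W : connect_sym (near m W).
Proof. by apply: sym_connect_sym => U U'; rewrite near_sym. Qed.

Lemma card_setD2 (W : {set T}) a b : a \in W -> b \in W -> a != b ->
  #|W :\: [set a; b]| = (#|W| - 2)%N.
Proof. by move=> aW bW ab; rewrite cardsDS ?cards2 ?ab // subUset !sub1set aW. Qed.

(** Both sets avoid [a], so their union lies in [W :\ a], which has [m.+1] elements. *)
Lemma near_share m (W : {set T}) a b c : #|W| = m.+2 ->
    a \in W -> b \in W -> c \in W -> a != b -> a != c ->
    perfect (W :\: [set a; b]) -> perfect (W :\: [set a; c]) ->
  near m W (W :\: [set a; b]) (W :\: [set a; c]).
Proof.
move=> Wm aW bW cW ab ac p1 p2; rewrite /near !subsetDl p1 p2.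
rewrite !card_setD2 // Wm subn2 !eqxx /=.
apply: leq_trans (_ : #|W :\ a| <= _)%N.
  apply: subset_leq_card; rewrite subUset.
  by rewrite !setDS // sub1set !inE eqxx.
by rewrite -ltnS -[X in (_ <= X)%N]Wm (cardsD1 a W) aW.
Qed.

Lemma gen_setD2 m (W U : {set T}) : #|W| = m.+2 -> U \subset W -> #|U| = m ->
  exists a b, [/\ a \in W, b \in W, a != b & U = W :\: [set a; b]].
Proof.
move=> Wm UW Um; have /cards2P[a [b [ab e]]] : #|W :\: U| == 2%N.
  by rewrite cardsDS // Wm Um -add2n addnK.
have [aW bW] : a \in W /\ b \in W.
  have : [set a; b] \subset W by rewrite -e subsetDl.
  by rewrite subUset !sub1set => /andP[].
by exists a, b; split=> //; rewrite -e setDDr setDv set0U; apply/esym/setIidPr.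
Qed.

(** For a target [W :\: [set x; y]], the path goes through [W :\: [set x; v]] or [W :\: [set x; u]]:
    consecutive omitted pairs share a vertex. The middle set is matched by exchanging one block at
    [x]. *)
Lemma near_all_nonedge m (W : {set T}) u v :
    #|W| = m.+2 -> u \in W -> v \in W -> u != v -> [set u; v] \notin E ->
    perfect (W :\: [set u; v]) ->
  forall U : {set T}, U \subset W -> #|U| = m -> perfect U ->
    connect (near m W) (W :\: [set u; v]) U.
Proof.
move=> Wm; wlog suff main: u v / forall x y, u \in W -> v \in W -> u != v ->
    [set u; v] \notin E -> perfect (W :\: [set u; v]) ->
    x \in W -> y \in W -> x != y -> perfect (W :\: [set x; y]) ->
    connect (near m W) (W :\: [set u; v]) (W :\: [set x; y]).
  move=> uW vW uv nuv puv U UW Um pU.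
  have [x [y [xW yW xy eU]]] := gen_setD2 Wm UW Um.
  by rewrite eU in pU *; apply: main.
move=> x y uW vW uv nuv puv xW yW xy pxy.
have [xu|xu] := eqVneq x u.
  by rewrite xu in xy pxy *; apply/connect1/near_share.
have [xv|xv] := eqVneq x v.
  rewrite xv in xy pxy *; rewrite setUC in puv *; rewrite eq_sym in uv.
  by apply/connect1/near_share.
have /perfectP[M ME MU] := puv.
have xU : x \in W :\: [set u; v] by rewrite !inE negb_or xu xv.
have [c [xcM cx]] := partner ME MU xU; rewrite !inE negb_or => /andP[/andP[cu cv] cW].
(* By [alpha2] the partner [c] of [x] is adjacent to [u] or [v], whose roles are symmetric. The
   block {x, c} can then be replaced by {u, c}. *)
wlog ucE : u v uW vW uv {nuv} puv MU xu xv xU cu cv / [set u; c] \in E.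
  move=> wl; have : [set u; c] \in E \/ [set v; c] \in E.
    have := @alpha2 u v c uv; rewrite [u == c]eq_sym [v == c]eq_sym => /(_ cu cv).
    by rewrite (negbTE nuv) /= => /orP.
  case=> [|vcE]; first exact: wl.
  by rewrite setUC; apply: wl => //; rewrite 1?setUC // eq_sym.
have pxv : perfect (W :\: [set x; v]).
  have -> : W :\: [set x; v] = [set u; c] :|: (W :\: [set u; v] :\: [set x; c]).
    apply/setP => z; rewrite !inE.
    case: (eqVneq z u) => [->|]; first by rewrite eq_sym (negbTE xu) (negbTE uv) uW.
    case: (eqVneq z c) => [->|]; first by rewrite (negbTE cx) (negbTE cv) cW orbT.
    by case: (z == x); case: (z == v).
  apply: perfectU1 => //.
    rewrite disjoint_sym disjoints_subset; apply/subsetP => z; rewrite !inE.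
    by case: (z == u); case: (z == c); rewrite ?orbT ?andbF.
  apply/perfectP; exists (M :\ [set x; c]); first exact: subset_trans (subsetDl _ _) ME.
  exact: partitionD1.
rewrite setUC in puv *; rewrite setUC in pxv.
apply: (connect_trans (y := W :\: [set v; x])); apply/connect1.
  by apply: near_share; rewrite // eq_sym.
by rewrite setUC; apply: near_share; rewrite // setUC.
Qed.

(** Write e = {a, c} and f = {b, d}. Replacing both blocks by the edge {a, b} matches W without {c,
    d}, and this set is adjacent to [W :\: e] through [c] and to [W :\: f] through [d]. *)
Lemma near_matching m (W : {set T}) (N : {set {set T}}) e f a b : #|W| = m.+2 ->
    N \subset E -> partition N W -> e \in N -> f \in N -> a \in e -> b \in f ->
    [set a; b] \in E ->
  connect (near m W) (W :\: e) (W :\: f).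
Proof.
move=> Wm NE NW eN fN ae bf abE.
have [->//|ef] := eqVneq e f.
have [aW bW] : a \in W /\ b \in W.
  by split; [apply: (subsetP (partitionS NW eN))|apply: (subsetP (partitionS NW fN))].
have dis : [disjoint e & f].
  by have /trivIsetP := partition_trivIset NW; apply.
have blk (g : {set T}) x : g \in N -> x \in g -> exists2 c, g = [set x; c] & c != x /\ c \in W.
  move=> gN xg; have [c [xcN cx cW]] := partner NE NW (subsetP (partitionS NW gN) _ xg).
  exists c => //; have /trivIsetP tN := partition_trivIset NW.
  apply/eqP/negPn/negP => gx; have := tN _ _ gN xcN gx.
  by rewrite -setI_eq0 => /eqP/setP/(_ x); rewrite !inE xg eqxx.
have pD (g : {set T}) : g \in N -> perfect (W :\: g).
  move=> gN; apply/perfectP; exists (N :\ g); last exact: partitionD1.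
  exact: subset_trans (subsetDl _ _) NE.
have [c ec [ca cW]] := blk _ _ eN ae; have [d fd [db dW]] := blk _ _ fN bf.
have ce : c \in e by rewrite ec !inE eqxx orbT.
have df : d \in f by rewrite fd !inE eqxx orbT.
have neq x y : x \in e -> y \in f -> x != y.
  move=> xe yf; apply: contraTneq dis => xy; apply/pred0Pn; exists x.
  by rewrite /= xe xy.
have pcd : perfect (W :\: [set c; d]).
  have -> : W :\: [set c; d] = [set a; b] :|: (W :\: e :\: f).
    apply/setP => z; rewrite ec fd !inE.
    case: (eqVneq z a) => [->|]; first by rewrite eq_sym (negbTE ca) aW (negbTE (neq _ _ ae df)).
    case: (eqVneq z b) => [->|]; first
      by rewrite [b == c]eq_sym (negbTE (neq _ _ ce bf)) [b == d]eq_sym (negbTE db) bW orbT.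
    by case: (z == c); case: (z == d).
  apply: perfectU1 => //.
    rewrite disjoint_sym disjoints_subset ec fd; apply/subsetP => z; rewrite !inE.
    by case: (z == a); case: (z == b); rewrite ?orbT ?andbF.
  apply/perfectP; exists (N :\ e :\ f).
    exact: subset_trans (subsetDl _ _) (subset_trans (subsetDl _ _) NE).
  by apply: partitionD1; [apply: partitionD1|rewrite !inE eq_sym ef].
have pe := pD _ eN; have pf := pD _ fN.
apply: (connect_trans (y := W :\: [set c; d])); apply/connect1.
  by rewrite ec setUC in pe *; apply: near_share; rewrite ?(neq _ _ ce df).
rewrite fd in pf *; rewrite setUC in pcd *; rewrite [[set b; d]]setUC in pf *.
by apply: near_share; rewrite // eq_sym (neq _ _ ce df).
Qed.

Lemma near_or_two_cliques m (W : {set T}) : #|W| = m.+2 ->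
  (forall U U' : {set T}, U \subset W -> #|U| = m -> perfect U ->
     U' \subset W -> #|U'| = m -> perfect U' -> connect (near m W) U U')
  \/ exists A, two_cliques W A.
Proof.
move=> Wm.
(* If some omitted pair is not an edge, every set is connected to the one omitting it. Otherwise all
   omitted pairs are edges ([gE]). *)
case: (pickP [pred x : T * T | [&& x.1 \in W, x.2 \in W, x.1 != x.2,
    [set x.1; x.2] \notin E & perfect (W :\: [set x.1; x.2])]]) => [[u v]|noN] /=.
  case/and5P=> uW vW uv nuv puv; left => U U' UW Um pU U'W U'm pU'.
  have near_uv := near_all_nonedge Wm uW vW uv nuv puv.
  apply: (connect_trans (y := W :\: [set u; v])); last exact: near_uv.
  by rewrite nears_sym; apply: near_uv.
have gE a b : a \in W -> b \in W -> a != b -> perfect (W :\: [set a; b]) ->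
    [set a; b] \in E.
  by move=> aW bW ab pab; move: (noN (a, b)); rewrite /= aW bW ab pab andbT /= => /negbFE.
case: (pickP [pred U : {set T} | [&& U \subset W, #|U| == m & perfect U]]) => [U0|no0]; last first.
  by left=> U U' UW Um pU; move: (no0 U); rewrite /= UW Um eqxx pU.
case/and3P=> U0W /eqP U0m pU0.
have [a0 [b0 [a0W b0W ab0 eU0]]] := gen_setD2 Wm U0W U0m.
rewrite eU0 in pU0.
(* The omitted pair of [U0] is an edge, so it completes a matching of [U0] to one of [W]. *)
have [N NE NW] : exists2 N : {set {set T}}, N \subset E & partition N W.
  apply/perfectP; have -> : W = [set a0; b0] :|: (W :\: [set a0; b0]).
    by rewrite -{1}(setID W [set a0; b0]) (setIidPr _) // subUset !sub1set a0W.
  apply: perfectU1 => //; first exact: gE.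
  by rewrite disjoint_sym disjoints_subset; apply/subsetP => z; rewrite !inE => /andP[].
have pD (g : {set T}) : g \in N -> perfect (W :\: g).
  move=> gN; apply/perfectP; exists (N :\ g); last exact: partitionD1.
  exact: subset_trans (subsetDl _ _) NE.
(* If [U] omits [x], it is adjacent to the set omitting the block of [N] at [x]; only the sets
   omitting a block of [N] remain to be compared. *)
have toN (U : {set T}) : U \subset W -> #|U| = m -> perfect U ->
    exists2 e, e \in N & connect (near m W) U (W :\: e).
  move=> UW Um pU; have [x [y [xW yW xy eU]]] := gen_setD2 Wm UW Um.
  have [c [xcN cx cW]] := partner NE NW xW; exists [set x; c] => //.
  rewrite eU in pU *; apply/connect1/near_share => //; rewrite 1?eq_sym //.
  exact: pD.
case: (pickP [pred x : {set T} * {set T} | [&& x.1 \in N, x.2 \in N &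
    ~~ connect (near m W) (W :\: x.1) (W :\: x.2)]]) => [[e0 f0]|conN] /=; last first.
  left=> U U' UW Um pU U'W U'm pU'.
  have [e eN Ue] := toN _ UW Um pU; have [f fN Uf] := toN _ U'W U'm pU'.
  apply: connect_trans Ue _; apply: (connect_trans (y := W :\: f)); last by rewrite nears_sym.
  by move: (conN (e, f)); rewrite /= eN fN /= => /negbFE.
case/and3P=> e0N f0N ne0f0; right.
(* The blocks in the component of [e0] cover one clique [A]; by [near_matching] no edge leaves [A],
   and [f0] lies outside it. *)
pose NA := [set e in N | connect (near m W) (W :\: e0) (W :\: e)].
pose A := cover NA.
have NAN : NA \subset N by apply/subsetP => e; rewrite inE => /andP[].
have AW : A \subset W.
  by rewrite -(cover_partition NW); apply/bigcupsP => e /(subsetP NAN); apply: bigcup_sup.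
have nE u v : u \in W -> v \in W -> u \in A -> v \notin A -> [set u; v] \notin E.
  move=> uW vW /bigcupP[e]; rewrite inE => /andP[eN ce ue] vA; apply/negP => uvE.
  have : v \in cover N by rewrite (cover_partition NW).
  case/bigcupP=> f fN vf; case/negP: vA; apply/bigcupP; exists f => //.
  by rewrite inE fN (connect_trans ce) //; exact: near_matching Wm NE NW eN fN ue vf uvE.
have /set0Pn[a ae0] := partition_neq0 NW e0N.
have /set0Pn[c cf0] := partition_neq0 NW f0N.
have aA : a \in A by apply/bigcupP; exists e0 => //; rewrite inE e0N /=.
have aW := subsetP AW _ aA.
have cW : c \in W := subsetP (partitionS NW f0N) _ cf0.
have cA : c \notin A.
  apply/bigcupP => -[e]; rewrite inE => /andP[eN ce] ce'.
  have /trivIsetP/(_ _ _ eN f0N) := partition_trivIset NW.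
  case: (eqVneq e f0) => [ef _|_ /(_ isT)]; first by case/negP: ne0f0; rewrite -ef.
  by rewrite -setI_eq0 => /eqP/setP/(_ c); rewrite !inE ce' cf0.
have pA : perfect A.
  apply/perfectP; exists NA; first exact: subset_trans NE.
  rewrite /partition eqxx (trivIsetS NAN (partition_trivIset NW)) /=.
  by apply: contraFN (partition0 NW) => /(subsetP NAN).
exists A; apply/two_cliquesP; split.
  split=> //; first by apply/set0Pn; exists a.
  - by apply/set0Pn; exists c; rewrite inE cA.
  - exact: perfect_even.
  by apply: perfect_even; apply/perfectP; exists N.
(* Two vertices on the same side are adjacent by [alpha2] applied with a third vertex on the other
   side, adjacent to neither: [c] for [A], [a] for its complement. *)
move=> u v uW vW uv; case: (boolP (u \in A)) => uA; case: (boolP (v \in A)) => vA /=.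
- have ne w : w \in A -> w != c by apply: contraTneq => ->.
  have := alpha2 uv (ne _ uA) (ne _ vA).
  by rewrite (negbTE (nE u c _ _ _ _)) // (negbTE (nE v c _ _ _ _)) // !orbF => ->.
- by apply/negbTE/nE.
- by rewrite setUC; apply/negbTE/nE.
have ne w : w \notin A -> w != a by apply: contraNneq => ->.
have := alpha2 uv (ne _ uA) (ne _ vA); rewrite ![[set _; a]]setUC.
by rewrite (negbTE (nE a u _ _ _ _)) // (negbTE (nE a v _ _ _ _)) // !orbF => ->.
Qed.

(** Induction on the size of the even clique: any two of its vertices form a block. *)
Lemma perfect_addclique (A U : {set T}) :
    ~~ odd #|A| -> (forall u v, u \in A -> v \in A -> u != v -> [set u; v] \in E) ->
    [disjoint A & U] -> perfect U -> perfect (A :|: U).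
Proof.
have [k] := ubnP #|A|; elim: k A => // k IH A /ltnSE-Ak oA cA dA pU.
have [->|/set0Pn[a aA]] := eqVneq A set0; first by rewrite set0U.
have [A1|/set0Pn[b]] := eqVneq (A :\ a) set0.
  by move: oA; rewrite (cardsD1 a A) aA A1 cards0.
rewrite !inE => /andP[ba bA].
have cD : #|A| = #|A :\ a :\ b|.+2.
  by rewrite (cardsD1 a A) aA (cardsD1 b (A :\ a)) !inE ba bA.
have -> : A :|: U = [set a; b] :|: (A :\ a :\ b :|: U).
  apply/setP => z; rewrite !inE.
  case: (eqVneq z a) => [->|]; first by rewrite aA.
  by case: (eqVneq z b) => [->|]; first by rewrite bA.
have sA : A :\ a :\ b \subset A by apply/subsetP => z; rewrite !inE => /and3P[].
apply: perfectU1; first by apply: cA; rewrite // eq_sym.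
  rewrite disjoints_subset subUset !sub1set !inE !eqxx !andbF /=.
  by rewrite !(disjointFr dA).
apply: IH => //.
- by move: Ak; rewrite cD; lia.
- by move: oA; rewrite cD /= negbK.
- by move=> u v /(subsetP sA) uA /(subsetP sA) vA; apply: cA.
by apply: disjointWl dA.
Qed.

Lemma two_cliquesC W A : two_cliques W A -> two_cliques W (W :\: A).
Proof.
case/two_cliquesP=> -[AW A0 B0 oA oW] ed; apply/two_cliquesP; split.
  split=> //; first exact: subsetDl.
    by rewrite setDDr setDv set0U (setIidPr AW).
  by rewrite cardsDS // oddB ?subset_leq_card // (negbTE oA) (negbTE oW).
move=> u v uW vW uv; rewrite ed // !inE uW vW !andbT.
by case: (u \in A); case: (v \in A).
Qed.

Lemma two_cliques_perfect (W A : {set T}) x y :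
  two_cliques W A -> x \in A -> y \in A -> x != y -> perfect (W :\: [set x; y]).
Proof.
move=> sWA xA yA xy; have /two_cliquesP[[AW A0 B0 oA oW] ed] := sWA.
have /two_cliquesP[[BW _ _ oB _] _] := two_cliquesC sWA.
have -> : W :\: [set x; y] = (A :\: [set x; y]) :|: ((W :\: A) :|: set0).
  apply/setP => z; rewrite !inE orbF.
  case: (eqVneq z x) => [->|_]; first by rewrite xA.
  case: (eqVneq z y) => [->|_]; first by rewrite yA.
  by case: (boolP (z \in A)) => // /(subsetP AW) ->.
apply: perfect_addclique.
- by rewrite card_setD2 // oddB ?(negbTE oA) // (cardD1 x) xA (cardD1 y) inE eq_sym xy yA.
- move=> u v; rewrite !inE => /andP[_ uA] /andP[_ vA] uv.
  by rewrite ed ?(subsetP AW) // uA vA.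
- by rewrite setU0 disjoints_subset; apply/subsetP => z; rewrite !inE => /andP[_ ->].
apply: perfect_addclique => //; last exact: perfect0.
- move=> u v; rewrite !inE => /andP[uA uW] /andP[vA vW] uv.
  by rewrite ed // (negbTE uA) (negbTE vA).
by rewrite disjoints_subset setC0 subsetT.
Qed.

(** No edge joins the two cliques, so every block stays on one side. If [b] were outside [A], the
    blocks inside [A] would perfectly match [A :\ a], whose size is odd. *)
Lemma two_cliques_side (W A : {set T}) a b : two_cliques W A -> a \in W -> b \in W ->
  perfect (W :\: [set a; b]) -> a \in A -> b \in A.
Proof.
case/two_cliquesP=> -[AW A0 B0 oA oW] ed aW bW /perfectP[M ME MU] aA.
apply/negPn/negP => bA.
have : ~~ odd #|A :\ a|.
  apply: perfect_even; apply/perfectP; exists [set e in M | e \subset A].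
    by apply: subset_trans ME; apply/subsetP => e; rewrite inE => /andP[].
  have sM : [set e in M | e \subset A] \subset M by apply/subsetP => e; rewrite inE => /andP[].
  rewrite /partition (trivIsetS sM (partition_trivIset MU)) andTb; apply/andP; split; last first.
    by apply: contraFN (partition0 MU) => /(subsetP sM).
  apply/eqP/setP => x; apply/bigcupP/idP => [[e]|].
    rewrite inE => /andP[eM /subsetP eA] xe; rewrite !inE eA // andbT.
    by apply: contraTneq (subsetP (partitionS MU eM) _ xe) => ->; rewrite !inE eqxx.
  rewrite !inE => /andP[xa xA].
  have xU : x \in W :\: [set a; b].
    by rewrite !inE negb_or xa (subsetP AW _ xA) andbT; apply: contraNneq bA => <-.
  have [c [xcM cx]] := partner ME MU xU; rewrite !inE negb_or => /andP[_ cW].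
  exists [set x; c]; last by rewrite !inE eqxx.
  rewrite inE xcM subUset !sub1set xA /=.
  have := ed x c (subsetP AW _ xA) cW; rewrite eq_sym cx (subsetP ME _ xcM) xA.
  by move/(_ isT)/esym/eqP.
by move: oA; rewrite (cardsD1 a A) aA /= negbK => ->.
Qed.

Lemma two_cliques_gen_side m (W A U : {set T}) : #|W| = m.+2 -> two_cliques W A ->
    U \subset W -> #|U| = m -> perfect U ->
  (W :\: U \subset A) || (W :\: U \subset W :\: A).
Proof.
move=> Wm sWA UW Um pU; have [a [b [aW bW ab eU]]] := gen_setD2 Wm UW Um.
rewrite eU in pU *; rewrite setDDr setDv set0U (setIidPr _) ?subUset !sub1set ?aW ?bW //.
rewrite !inE aW bW !andbT; case: (boolP (a \in A)) => aA.
  by rewrite (two_cliques_side sWA aW bW pU aA).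
by rewrite setUC in pU; rewrite (contraNN (two_cliques_side sWA bW aW pU)).
Qed.

(** If the omitted pairs are {a, b} and {c, d}, the set omitting {a, c} is adjacent to both; it has
    a perfect matching because two vertices are removed from one even clique. *)
Lemma two_cliques_connect m (W A U U' : {set T}) : #|W| = m.+2 -> two_cliques W A ->
    U \subset W -> #|U| = m -> perfect U -> W :\: U \subset A ->
    U' \subset W -> #|U'| = m -> perfect U' -> W :\: U' \subset A ->
  connect (near m W) U U'.
Proof.
move=> Wm sWA UW Um pU UA U'W U'm pU' U'A.
have [a [b [aW bW ab eU]]] := gen_setD2 Wm UW Um.
have [c [d [cW dW cd eU']]] := gen_setD2 Wm U'W U'm.
rewrite eU eU' in pU pU' UA U'A *.
have sub x y : x \in W -> y \in W -> W :\: (W :\: [set x; y]) \subset A -> (x \in A) && (y \in A).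
  by move=> xW yW; rewrite setDDr setDv set0U (setIidPr _) ?subUset !sub1set ?xW.
have /andP[aA bA] := sub _ _ aW bW UA; have /andP[cA dA] := sub _ _ cW dW U'A.
have [ac|ac] := eqVneq a c.
  by rewrite -ac in cd pU' *; apply/connect1/near_share.
have pac := two_cliques_perfect sWA aA cA ac.
apply: (connect_trans (y := W :\: [set a; c])); first exact/connect1/near_share.
by rewrite setUC in pac *; apply/connect1/near_share; rewrite // eq_sym.
Qed.
End Matchings.

(** * Induced complete bipartite subgraphs and their number *)

Lemma compl_edgesE n (D : {set {set 'I_n}}) u v :
  u != v -> ([set u; v] \in compl_edges D) = ~~ adj D u v.
Proof. by move=> uv; rewrite inE cards2 /adj uv. Qed.

(** The complement of a complete bipartite graph is a disjoint union of two cliques; [A] is the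
    image of the left part. *)
Lemma induced_bipartiteP n (D : {set {set 'I_n}}) (W : {set 'I_n}) a b :
  reflect (exists A : {set 'I_n}, [/\ A \subset W, #|A| = a, #|W :\: A| = b
    & forall u v, u \in W -> v \in W -> u != v ->
        ([set u; v] \in compl_edges D) = ((u \in A) == (v \in A))])
  (induced_iso D W (@complete_bipartite a b)).
Proof.
apply: (iffP existsP) => [[f /and3P[/injectiveP finj /eqP imf /forallP fadj]]|].
  exists [set f (inl x) | x : 'I_a].
  have inA z : (f z \in [set f (inl x) | x : 'I_a]) = is_inl z.
    apply/imsetP/idP => [[x _ /finj ->]//|]; by case: z => // x _; exists x.
  have AW : [set f (inl x) | x : 'I_a] \subset W.
    by rewrite -imf; apply/subsetP => _ /imsetP[x _ ->]; apply: imset_f.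
  have cA : #|[set f (inl x) | x : 'I_a]| = a.
    by rewrite card_imset ?card_ord // => x y /finj[].
  split=> //; first by rewrite cardsDS // -imf card_imset // card_sum !card_ord cA addKn.
  move=> u v; rewrite -imf => /imsetP[x _ ->] /imsetP[y _ ->] uv.
  rewrite compl_edgesE // !inA; have /forallP/(_ y)/eqP <- := fadj x.
  by rewrite /complete_bipartite negbK.
case=> A [AW <- <- ed] {a b}.
pose f (z : 'I_#|A| + 'I_#|W :\: A|) : 'I_n :=
  match z with inl i => enum_val i | inr j => enum_val j end.
have fW z : f z \in W.
  by case: z => i /=; [apply: (subsetP AW)|apply: (subsetP (subsetDl W A))]; apply: enum_valP.
have fA z : (f z \in A) = is_inl z.
  by case: z => i /=; have := enum_valP i; rewrite ?inE // => /andP[/negbTE].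
have finj : injective f.
  move=> x y fxy; have := fA x; rewrite fxy fA; move: fxy.
  by case: x => i; case: y => j //= /enum_val_inj ->.
exists [ffun z => f z]; apply/and3P; split.
- by apply/injectiveP => x y; rewrite !ffunE => /finj.
- rewrite eqEcard; apply/andP; split.
    by apply/subsetP => _ /imsetP[z _ ->]; rewrite ffunE.
  rewrite card_imset => [|x y]; last by rewrite !ffunE => /finj.
  by rewrite card_sum !card_ord -(cardsID A W) (setIidPr AW).
apply/forallP => x; apply/forallP => y; rewrite !ffunE.
have [<-|xy] := eqVneq x y; first by rewrite /complete_bipartite /adj !eqxx.
have fxy : f x != f y by apply: contra_neq xy => /finj.
by rewrite -[adj _ _ _]negbK -compl_edgesE // ed // !fA.
Qed.

Section Counting.
Variables (n p : nat) (D : {set {set 'I_n}}).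

Definition good : {set {set 'I_n}} :=
  [set W : {set 'I_n} | (#|W| == (2 * p).+2) && [exists A, two_cliques (compl_edges D) W A]].

(** Take [A] to be the smaller clique. It is even and nonempty, and the two sizes add up to 2p+2, so
    its size is 2+i with i even and i < p. *)
Lemma good_induced (W : {set 'I_n}) :
  W \in good <-> exists i, [/\ (i < p)%N, ~~ odd i &
    induced_iso D W (@complete_bipartite (2 + i) (2 * p - i))].
Proof.
rewrite inE; split=> [/andP[/eqP Wp /existsP[A0 sA0]]|[i [ip oi /induced_bipartiteP]]].
  have [A sA AB] : exists2 A, two_cliques (compl_edges D) W A & (#|A| <= #|W :\: A|)%N.
    have [le|/ltnW le] := leqP #|A0| #|W :\: A0|; first by exists A0.
    exists (W :\: A0); first exact: two_cliquesC.
    have /two_cliquesP[[AW _ _ _ _] _] := sA0.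
    by rewrite setDDr setDv set0U (setIidPr AW).
  have /two_cliquesP[[AW A_0 B_0 oA oW] ed] := sA.
  have cW := cardsID A W; rewrite (setIidPr AW) Wp in cW.
  have A2 : (2 <= #|A|)%N by move: A_0 oA; rewrite -card_gt0; case: #|A| => [|[]].
  exists (#|A| - 2)%N; split; [lia|by rewrite oddB // (negbTE oA)|].
  by apply/induced_bipartiteP; exists A; split=> //; lia.
case=> A [AW cA cB ed]; have cW := cardsID A W; rewrite (setIidPr AW) cA cB in cW.
have Wp : #|W| = (2 * p).+2 by lia.
rewrite Wp eqxx; apply/existsP; exists A; apply/two_cliquesP; split=> //.
split=> //; rewrite -?card_gt0 ?cA ?cB ?Wp //.
- by rewrite subn_gt0; lia.
- by rewrite oddD.
- by rewrite /= negbK oddM.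
Qed.

(** The sides are determined up to a swap, since the side of [w] consists of [w] and its neighbours
    in the complement graph. A swap gives 2+i = 2p-j, which forces i = j = p-1. *)
Lemma induced_uniq (W : {set 'I_n}) i j : (i < p)%N -> (j < p)%N ->
    induced_iso D W (@complete_bipartite (2 + i) (2 * p - i)) ->
    induced_iso D W (@complete_bipartite (2 + j) (2 * p - j)) -> i = j.
Proof.
move=> ip jp /induced_bipartiteP[A [AW cA cB ed]] /induced_bipartiteP[A' [AW' cA' cB' ed']].
have /card_gt0P[w wA] : (0 < #|A|)%N by rewrite cA.
have wW := subsetP AW _ wA.
have key v : v \in W -> (v \in A) = ((v \in A') == (w \in A')).
  move=> vW; have [->|vw] := eqVneq v w; first by rewrite wA eqxx.
  by have := ed v w vW wW vw; rewrite ed' // wA => ->; rewrite eqb_id.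
case: (boolP (w \in A')) => wA'.
  have AA' : A = A'.
    apply/setP => v; case: (boolP (v \in W)) => vW; first by rewrite key // wA' eqb_id.
    by rewrite !(contraNF (subsetP _ v) vW).
  by move: cA; rewrite AA' cA' => /eqP; rewrite eqn_add2l => /eqP.
have AA' : A = W :\: A'.
  apply/setP => v; rewrite inE; case: (boolP (v \in W)) => vW.
    by rewrite key // (negbTE wA') eqbF_neg andbT.
  by rewrite andbF (contraNF (subsetP _ v) vW).
by move: cA; rewrite AA' cB'; lia.
Qed.

(** Double counting: each good [W] is counted in exactly one summand, and no other [W] is
    counted. *)
Lemma card_good : #|good| =
  (\sum_(0 <= i < p | ~~ odd i) nb_induced D (@complete_bipartite (2 + i) (2 * p - i)))%N.
Proof.
rewrite big_mkord -sum1_card big_mkcond /=.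
under [RHS]eq_bigr => i _ do rewrite /nb_induced -sum1_card big_mkcond /=.
rewrite exchange_big; apply: eq_bigr => W _ /=.
under [RHS]eq_bigr => i _ do rewrite inE.
case: (boolP (W \in good)) => [/good_induced[i [ip oi iso]]|nW].
  rewrite (bigD1 (Ordinal ip)) //= iso big1 ?addn0 // => j /andP[_ ji].
  case: ifP => // isoj; case/eqP: ji; apply: val_inj => /=.
  exact: induced_uniq isoj iso.
rewrite big1 // => i oi; case: ifP => // iso; case/negP: nW; apply/good_induced.
by exists i.
Qed.
End Counting.

Import GRing.Theory.
Local Open Scope ring_scope.

(** * Monomials and syzygies *)

Section Monomials.
Variables (K : fieldType) (n : nat).
Implicit Types (V W : {set 'I_n}) (m : 'X_{1..n}).

Lemma mnm_mesym1E V i : mesym1 V i = (i \in V) :> nat.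
Proof. by rewrite mnmE. Qed.

Lemma mesym1_le V W : (mesym1 V <= mesym1 W)%MM = (V \subset W).
Proof.
apply/mnm_lepP/subsetP => VW i; last by rewrite !mnm_mesym1E; case: (boolP (i \in V)) => // /VW ->.
by have := VW i; rewrite !mnm_mesym1E => + iV; rewrite iV lt0b.
Qed.

Lemma mesym1B V W : (mesym1 W - mesym1 V)%MM = mesym1 (W :\: V).
Proof. by apply/mnmP => i; rewrite mnmBE !mnm_mesym1E inE; do 2!case: (_ \in _). Qed.

Lemma mesym1_squarefree m : (forall i, (m i <= 1)%N) -> m = mesym1 [set i | (0 < m i)%N].
Proof. by move=> m1; apply/mnmP => i; rewrite mnm_mesym1E inE; case: (m i) (m1 i) => [|[]]. Qed.

Lemma mcoeffMX_le (f : {mpoly K[n]}) m m' :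
  (f * 'X_[m'])@_m = if (m' <= m)%MM then f@_(m - m') else 0.
Proof.
case: (boolP (m' <= m)%MM) => [h|nh]; first by rewrite -{1}(submK h) addmC mcoeffMX.
apply: memN_msupp_eq0; apply: contraNN nh => /msuppM_le /allpairsP[[m1 m2] /= [_]].
by rewrite msuppX inE => /eqP-> ->; apply: lem_addl.
Qed.

Lemma mdeg_le m m' : (m <= m')%MM -> (mdeg m <= mdeg m')%N.
Proof. by move/mnm_lepP=> le; rewrite !mdegE; apply: leq_sum => i _. Qed.

Lemma mdeg_sub m m' : (m' <= m)%MM -> (mdeg (m - m') + mdeg m' = mdeg m)%N.
Proof. by move=> le; rewrite -mdegD submK. Qed.

(** Every term of a polynomial without constant term is divisible by some variable. *)
Lemma mpoly_scaleX (f : {mpoly K[n]}) (V : lmodType {mpoly K[n]}) (P : V -> Prop) z :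
    P 0 -> (forall x y, P x -> P y -> P (x + y)) -> (forall i g, P (('X_i * g) *: z)) ->
  f@_0%MM = 0 -> P (f *: z).
Proof.
move=> P0 PD PX f0; rewrite [f]mpolyE scaler_suml big_seq.
apply: (big_ind P) => // m; rewrite mcoeff_msupp => fm.
have m0 : m != 0%MM by apply: contraNneq fm => ->; rewrite f0.
have [i mi] : exists i, (0 < m i)%N.
  apply/existsP; apply: contraNT m0 => /existsPn m0; apply/eqP/mnmP => i.
  by rewrite mnm0E; apply/eqP; rewrite -leqn0 leqNgt.
have -> : m = (U_(i) + (m - U_(i)))%MM by rewrite addmC submK // lep1mP -lt0n.
by rewrite mpolyXD scalerAr; apply: PX.
Qed.
End Monomials.

(** * The product of the maximal ideal with a kernel *)

Section MaximalIdealTimesKernel.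
Variables (K : fieldType) (n : nat).
Local Notation S := {mpoly K[n]}.

(* The submodule (x_1, ..., x_n) Ker B. *)
Definition mker a b (B : 'M[S]_(a, b)) (v : 'rV[S]_a) : Prop :=
  exists2 z : 'I_n -> 'rV[S]_a, forall i, z i *m B = 0 & v = \sum_i 'X_i *: z i.

Variables (a b : nat) (B : 'M[S]_(a, b)).
Implicit Types (v z : 'rV[S]_a).

Lemma mker0 : mker B 0.
Proof.
exists (fun=> 0) => [i|]; first by rewrite mul0mx.
by rewrite big1 // => i _; rewrite scaler0.
Qed.

Lemma mkerD v v' : mker B v -> mker B v' -> mker B (v + v').
Proof.
case=> z zB -> [z' zB' ->]; exists (fun i => z i + z' i) => [i|].
  by rewrite mulmxDl zB zB' addr0.
by rewrite -big_split; apply: eq_bigr => i _; rewrite scalerDr.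
Qed.

Lemma mkerZ f v : mker B v -> mker B (f *: v).
Proof.
case=> z zB ->; exists (fun i => f *: z i) => [i|]; first by rewrite -scalemxAl zB scaler0.
by rewrite scaler_sumr; apply: eq_bigr => i _; rewrite !scalerA mulrC.
Qed.

Lemma mker_sum (I : Type) (r : seq I) (P : pred I) (F : I -> 'rV[S]_a) :
  (forall i, P i -> mker B (F i)) -> mker B (\sum_(i <- r | P i) F i).
Proof. by move=> h; apply: (big_ind (mker B)) => //; [apply: mker0|apply: mkerD]. Qed.

Lemma mkerX i z : z *m B = 0 -> mker B ('X_i *: z).
Proof.
move=> zB; exists (fun j => if j == i then z else 0) => [j|].
  by case: ifP; rewrite ?mul0mx.
by rewrite (bigD1 i) //= eqxx big1 ?addr0 // => j /negbTE->; rewrite scaler0.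
Qed.

Lemma mker_scale f z : f@_0%MM = 0 -> z *m B = 0 -> mker B (f *: z).
Proof.
move=> f0 zB; apply: (mpoly_scaleX (P := mker B)) f0 => [|x y|i g].
- exact: mker0.
- exact: mkerD.
by rewrite -scalerA; apply: mkerX; rewrite -scalemxAl zB scaler0.
Qed.

Lemma mker_mulmx c (v : 'rV[S]_c) (Z : 'M[S]_(c, a)) :
  (forall k, (v 0 k)@_0%MM = 0) -> Z *m B = 0 -> mker B (v *m Z).
Proof.
move=> v0 ZB; rewrite mulmx_sum_row; apply: mker_sum => k _.
by apply: mker_scale => //; rewrite -row_mul ZB row0.
Qed.
End MaximalIdealTimesKernel.

(** A comparison map [C] over the same target carries kernel to kernel and is linear. *)
Lemma mker_trans (K : fieldType) n a a' b (B : 'M[{mpoly K[n]}]_(a, b)) (B' : 'M_(a', b))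
    (C : 'M_(a, a')) v : B = C *m B' -> mker B v -> mker B' (v *m C).
Proof.
move=> eB [z zB ->]; exists (fun i => z i *m C) => [i|].
  by rewrite -mulmxA -eB.
by rewrite mulmx_suml; apply: eq_bigr => i _; rewrite -scalemxAl.
Qed.

(** * Syzygies of the matching monomials in degree 2p+2 *)

Section Syzygies.
Variables (K : fieldType) (n p : nat) (E : {set {set 'I_n}}).
Hypothesis E2 : forall e, e \in E -> #|e| = 2%N.
Hypothesis alpha2 : forall a b c, a != b -> a != c -> b != c ->
  [|| [set a; b] \in E, [set a; c] \in E | [set b; c] \in E].
Local Notation S := {mpoly K[n]}.

Definition gens : {set {set 'I_n}} := [set V : {set 'I_n} | (#|V| == 2 * p)%N && perfect E V].
Definition gen (u : 'I_#|gens|) : {set 'I_n} := enum_val u.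
Definition gen_col : 'cV[S]_#|gens| := \col_u 'X_[mesym1 (gen u)].

Lemma gen_perfect u : #|gen u| = (2 * p)%N /\ perfect E (gen u).
Proof. by have := enum_valP u; rewrite inE => /andP[/eqP]. Qed.

Lemma gen_inj : injective gen.
Proof. exact: enum_val_inj. Qed.

Lemma genP (V : {set 'I_n}) : #|V| = (2 * p)%N -> perfect E V -> exists u, gen u = V.
Proof.
move=> V2p pV; have gV : V \in gens by rewrite inE V2p eqxx.
by exists (enum_rank_in gV V); apply: enum_rankK_in.
Qed.

(** The element x^(w-U) e_U of multidegree [w]; the subtraction is truncated, so this is meant for
    x^U dividing x^w. *)
Definition elt (w : 'X_{1..n}) u : 'rV[S]_#|gens| :=
  'X_[w - mesym1 (gen u)] *: delta_mx 0 u.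

Lemma elt_mul w u : (mesym1 (gen u) <= w)%MM -> elt w u *m gen_col = ('X_[w])%:M.
Proof.
move=> uw; apply/matrixP => i j; rewrite !ord1 -scalemxAl -rowE !mxE eqxx mulr1n.
by rewrite -mpolyXD submK.
Qed.

(** Some variable has a larger exponent in x^w than in the lcm of the two generators; it factors out
    of the difference and leaves a syzygy. *)
Lemma elt_step w u u' : (mesym1 (gen u) <= w)%MM -> (mesym1 (gen u') <= w)%MM ->
  (#|gen u :|: gen u'| < mdeg w)%N -> mker gen_col (elt w u - elt w u').
Proof.
move=> uw u'w lt; have [i iw] : exists i, ((i \in gen u :|: gen u') < w i)%N.
  apply/existsP; apply: contraTT lt => /existsPn h; rewrite -leqNgt -mdeg_mesym1.
  by apply: mdeg_le; apply/mnm_lepP => i; rewrite mnm_mesym1E leqNgt.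
have eX v : (i \in gen v <= (i \in gen u :|: gen u'))%N -> (mesym1 (gen v) <= w)%MM ->
    (mesym1 (gen v) <= w - U_(i))%MM /\ elt w v = 'X_i *: elt (w - U_(i)) v.
  move=> iv vw; have le j : (mesym1 (gen v) j + (i == j) <= w j)%N.
    have := mnm_lepP vw j; rewrite mnm_mesym1E; case: (eqVneq i j) => [<-|]; last by rewrite addn0.
    by rewrite addn1 => _; apply: leq_ltn_trans iw.
  split; first by apply/mnm_lepP => j; rewrite mnmBE mnm1E; move: (le j); case: (i == j); lia.
  rewrite /elt scalerA -mpolyXD; congr ('X_[_] *: _); apply/mnmP => j.
  by rewrite mnmDE !mnmBE !mnm1E; move: (le j); case: (i == j); lia.
have [|u1 ->] := eX u _ uw; first by rewrite inE; case: (_ \in _).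
have [|u2 ->] := eX u' _ u'w; first by rewrite inE; do 2!case: (_ \in _).
by rewrite -scalerBr; apply: mkerX; rewrite mulmxBl !elt_mul // subrr.
Qed.

Lemma elt_connect (W : {set 'I_n}) u u' : #|W| = (2 * p).+2 ->
    connect (near E (2 * p) W) (gen u) (gen u') -> gen u \subset W ->
  mker gen_col (elt (mesym1 W) u - elt (mesym1 W) u').
Proof.
move=> Wp /connectP[q]; elim: q u => [|V q IH] u /=.
  by move=> _ /gen_inj-> _; rewrite subrr; apply: mker0.
case/andP=> /and3P[_ /and3P[VW /eqP V2p pV] le] pq lq uW.
have [v vV] := genP V2p pV; rewrite -vV in pq lq le VW *.
rewrite -[elt _ u](subrK (elt (mesym1 W) v)) -addrA; apply: mkerD; last exact: IH.
by apply: elt_step; rewrite ?mesym1_le // mdeg_mesym1 Wp.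
Qed.

(** As the coefficients sum to zero, one fixed [elt w u0] may be subtracted from every term. *)
Lemma mker_group w (Q : pred 'I_#|gens|) (c : 'I_#|gens| -> K) :
    \sum_(u | Q u) c u = 0 ->
    (forall u u', Q u -> Q u' -> mker gen_col (elt w u - elt w u')) ->
  mker gen_col (\sum_(u | Q u) (c u)%:MP *: elt w u).
Proof.
move=> c0 h; case: (pickP Q) => [u0 Qu0|Q0]; last by rewrite big_pred0 //; apply: mker0.
have c0X : \sum_(u | Q u) (c u)%:MP = 0 :> S.
  by rewrite -(raddf_sum (@mpolyC n K)) c0 raddf0.
have -> : \sum_(u | Q u) (c u)%:MP *: elt w u =
    \sum_(u | Q u) (c u)%:MP *: (elt w u - elt w u0) + (\sum_(u | Q u) (c u)%:MP) *: elt w u0.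
  rewrite scaler_suml -big_split; apply: eq_bigr => u _.
  by rewrite /= -scalerDr subrK.
rewrite c0X scale0r addr0.
by apply: mker_sum => u Qu; apply: mkerZ; apply: h.
Qed.

(** A fixed choice of one of the two cliques; the default [set0] occurs only when there are none. *)
Definition side (W : {set 'I_n}) : {set 'I_n} := odflt set0 [pick A | two_cliques E W A].

Definition splits (W : {set 'I_n}) := (#|W| == (2 * p).+2) && [exists A, two_cliques E W A].

Lemma sideP W : splits W -> #|W| = (2 * p).+2 /\ two_cliques E W (side W).
Proof.
case/andP=> /eqP Wp /existsP[A sA]; split=> //; rewrite /side.
by case: pickP => //= /(_ A); rewrite sA.
Qed.

(* For [W] made of two even cliques: the coefficients, in multidegree x^W, on
   one of the two components. *)
Definition Phi (W : {set 'I_n}) (s : 'rV[S]_#|gens|) : K :=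
  \sum_(u | (gen u \subset W) && (W :\: gen u \subset side W))
     (s 0 u)@_(mesym1 (W :\: gen u)).

Lemma Phi_is_linear W (c : K) s t : Phi W (c%:MP *: s + t) = c * Phi W s + Phi W t.
Proof.
rewrite /Phi mulr_sumr -big_split; apply: eq_bigr => u _.
by rewrite !mxE mcoeffD mcoeffCM.
Qed.

Lemma PhiD W s t : Phi W (s + t) = Phi W s + Phi W t.
Proof. by rewrite -[X in X + t]scale1r -mpolyC1 Phi_is_linear mul1r. Qed.

Lemma Phi0 W : Phi W 0 = 0.
Proof. by apply: (addrI (Phi W 0)); rewrite -PhiD !addr0. Qed.

Lemma PhiZ W c s : Phi W (c%:MP *: s) = c * Phi W s.
Proof. by rewrite -[X in Phi W X]addr0 Phi_is_linear Phi0 addr0. Qed.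

Lemma Phi_sum W (I : Type) (r : seq I) (P : pred I) (F : I -> 'rV[S]_#|gens|) :
  Phi W (\sum_(i <- r | P i) F i) = \sum_(i <- r | P i) Phi W (F i).
Proof. exact: (big_morph (Phi W) (PhiD W) (Phi0 W)). Qed.

Lemma gen_mulE (s : 'rV[S]_#|gens|) w : ((s *m gen_col) 0 0)@_w =
  \sum_(u | (mesym1 (gen u) <= w)%MM) (s 0 u)@_(w - mesym1 (gen u)).
Proof.
rewrite mxE raddf_sum [RHS]big_mkcond /=; apply: eq_bigr => u _.
by rewrite mxE mcoeffMX_le.
Qed.

(** On x_i z only the sets U avoiding i count. If i is not in [side W], there are none. Otherwise
    every generator inside [W :\ i] omits a pair on that side, and the sum is the whole coefficient
    of x^(W-i) in the image of the syzygy z, which is zero. *)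
Lemma Phi_mker W s : splits W -> mker gen_col s -> Phi W s = 0.
Proof.
move=> /sideP[Wp sW] [z zX ->]; rewrite Phi_sum big1 // => i _.
have /two_cliquesP[[AW _ _ _ _] _] := sW.
transitivity (\sum_(u | [&& gen u \subset W, W :\: gen u \subset side W & i \in W :\: gen u])
     (z i 0 u)@_(mesym1 (W :\: gen u :\ i))).
  rewrite /Phi; under [RHS]eq_bigl => u do rewrite andbA.
  rewrite [RHS]big_mkcondr; apply: eq_bigr => u _.
  by rewrite mxE mulrC mcoeffMX_le -mesym1_set1 mesym1_le sub1set mesym1B.
case: (boolP (i \in side W)) => iA; last first.
  by rewrite big_pred0 // => u; apply/and3P => -[_ /subsetP uA /uA]; apply/negP.
have iW := subsetP AW _ iA.
have := congr1 (fun M : 'M_1 => (M 0 0)@_(mesym1 (W :\ i))) (zX i).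
rewrite gen_mulE [in RHS]mxE mcoeff0 => e0; rewrite -[RHS]e0; apply: eq_big => u; last first.
  by move=> _; rewrite mesym1B !setDDl setUC.
rewrite mesym1_le subsetD1; apply/and3P/andP => [[uW _]|[uW iu]]; first by rewrite inE => /andP[].
have [u2p pu] := gen_perfect u.
split; rewrite ?inE ?iu //.
have /orP[//|/subsetP/(_ i)] := two_cliques_gen_side E2 Wp sW uW u2p pu.
by rewrite !inE iu iW iA => /(_ isT).
Qed.

Lemma PhiE W V u : Phi W ('X_[mesym1 V] *: delta_mx 0 u) =
  [&& gen u \subset W, W :\: gen u \subset side W & V == W :\: gen u]%:R.
Proof.
rewrite /Phi big_mkcond (bigD1 u) //= big1 ?addr0 => [|v vu].
  rewrite !mxE !eqxx mulr1 mcoeffX (inj_eq (@inj_mesym1 n)).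
  by case: (gen u \subset W); case: (_ \subset _).
by rewrite !mxE (negbTE vu) andbF mulr0 mcoeff0 if_same.
Qed.

Lemma two_cliques_gen (W A : {set 'I_n}) : #|W| = (2 * p).+2 -> two_cliques E W A ->
  exists u, [/\ gen u \subset W, W :\: gen u \subset A & W :\: gen u != set0].
Proof.
move=> Wp sA; have /two_cliquesP[[AW A0 _ oA _] _] := sA.
have /set0Pn[a aA] := A0.
have [A1|/set0Pn[b]] := eqVneq (A :\ a) set0.
  by move: oA; rewrite (cardsD1 a A) aA A1 cards0.
rewrite !inE eq_sym => /andP[ab bA].
have [aW bW] := (subsetP AW _ aA, subsetP AW _ bA).
have [|u uE] := genP _ (two_cliques_perfect E2 sA aA bA ab).
  by rewrite card_setD2 // Wp subn2.
exists u; rewrite uE subsetDl setDDr setDv set0U (setIidPr _); last first.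
  by rewrite subUset !sub1set aW.
by split=> //; [rewrite subUset !sub1set aA|apply/set0Pn; exists a; rewrite !inE eqxx].
Qed.

(** The witness is the difference of two elements of multidegree x^W, one from each component. *)
Lemma Phi_surj W : splits W -> exists2 s : 'rV[S]_#|gens|,
  s *m gen_col = 0 & forall W', Phi W' s = (W' == W)%:R.
Proof.
move=> gW; have [Wp sW] := sideP gW.
have [u [uW uA u0]] := two_cliques_gen Wp sW.
have [v [vW vA v0]] := two_cliques_gen Wp (two_cliquesC sW).
exists (elt (mesym1 W) u + (-1)%:MP *: elt (mesym1 W) v) => [|W'].
  rewrite mulmxDl -scalemxAl !elt_mul ?mesym1_le //.
  by rewrite mpolyCN mpolyC1 scaleN1r subrr.
rewrite PhiD PhiZ /elt !mesym1B !PhiE mulN1r.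
have [->|W'W] := eqVneq W' W.
  rewrite uW uA vW eqxx /= ?andbT; case: (boolP (_ \subset _)) => [vA'|]; last by rewrite subr0.
  have /set0Pn[x xv] := v0; have := subsetP vA' _ xv.
  by have := subsetP vA _ xv; rewrite inE => /andP[/negbTE->].
(* U and its complement in W determine W, so no other functional sees these terms. *)
have ne t : gen t \subset W -> gen t \subset W' -> (W :\: gen t == W' :\: gen t) = false.
  move=> tW tW'; apply: contra_neqF W'W => /eqP e.
  by rewrite -(setID W' (gen t)) -(setID W (gen t)) e (setIidPr tW) (setIidPr tW').
have z t : gen t \subset W ->
    [&& gen t \subset W', W' :\: gen t \subset side W' & W :\: gen t == W' :\: gen t] = false.
  by move=> tW; case: (boolP (gen t \subset W')) => //= tW'; rewrite ne // andbF.
by rewrite !z // subrr.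
Qed.

(** Within one component the differences of the [elt w u] lie in (x_1, ..., x_n) Syz, so it is
    enough that the coefficients sum to zero on each component. *)
Lemma multidegree_ker (c : 'I_#|gens| -> K) w : mdeg w = (2 * p).+2 ->
    \sum_(u | (mesym1 (gen u) <= w)%MM) c u = 0 ->
    (forall W, splits W -> w = mesym1 W ->
      \sum_(u | (gen u \subset W) && (W :\: gen u \subset side W)) c u = 0) ->
  mker gen_col (\sum_(u | (mesym1 (gen u) <= w)%MM) (c u)%:MP *: elt w u).
Proof.
move=> wp c0 cW; case: (boolP [forall i, w i <= 1]%N) => [/forallP w1|]; last first.
  rewrite negb_forall => /existsP[i]; rewrite -ltnNge => wi.
  apply: mker_group => // u u' uw u'w; apply: elt_step => //.
  rewrite -(mdeg_mesym1 (gen u :|: gen u')).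
  (* Since [w i] is at least 2, the lcm times x_i still divides x^w, so the lcm has smaller
     degree. *)
  have le j : (mesym1 (gen u :|: gen u') j + (i == j) <= w j)%N.
    rewrite mnm_mesym1E inE; have [<-|] := eqVneq i j.
      by rewrite addn1; apply: leq_trans wi; case: (_ || _).
    move: (mnm_lepP uw j) (mnm_lepP u'w j); rewrite !mnm_mesym1E addn0.
    by case: (j \in gen u); case: (j \in gen u').
  rewrite -[X in (X <= _)%N]addn1 -(mdeg1 i) -mdegD; apply: mdeg_le; apply/mnm_lepP => j.
  by rewrite mnmDE mnm1E.
have [W wE] : exists W, w = mesym1 W by exists [set i | (0 < w i)%N]; apply: mesym1_squarefree.
have Wp : #|W| = (2 * p).+2 by rewrite -mdeg_mesym1 -wE.
have [con|[A sA]] := near_or_two_cliques E2 alpha2 Wp.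
  apply: mker_group => // u u'; rewrite wE !mesym1_le => uW u'W.
  have [u2p pu] := gen_perfect u; have [u'2p pu'] := gen_perfect u'.
  by apply: elt_connect => //; apply: con.
have gW : splits W by rewrite /splits Wp eqxx; apply/existsP; exists A.
have [_ sW] := sideP gW; have sC := two_cliquesC sW.
have con B u u' : two_cliques E W B -> (gen u \subset W) && (W :\: gen u \subset B) ->
    (gen u' \subset W) && (W :\: gen u' \subset B) ->
    mker gen_col (elt w u - elt w u').
  move=> sB /andP[uW uA] /andP[u'W u'A].
  have [u2p pu] := gen_perfect u; have [u'2p pu'] := gen_perfect u'.
  by rewrite wE; apply: elt_connect => //; apply: (two_cliques_connect E2 Wp sB).
have cA := cW _ gW wE.
rewrite (bigID (fun u => W :\: gen u \subset side W)) /=.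
apply: mkerD; apply: mker_group.
- by rewrite -[RHS]cA; apply: eq_bigl => u; rewrite wE mesym1_le.
- by move=> u u'; rewrite wE !mesym1_le -wE; apply: con sW.
(* The sum over the second component is the total sum minus the sum over [side W]. *)
- move: c0; rewrite (bigID (fun u => W :\: gen u \subset side W)) /=.
  suff -> : \sum_(u | (mesym1 (gen u) <= w)%MM && (W :\: gen u \subset side W)) c u = 0.
    by rewrite add0r.
  by rewrite -[RHS]cA; apply: eq_bigl => u; rewrite wE mesym1_le.
move=> u u' hu hu'.
have cv v : (mesym1 (gen v) <= w)%MM && ~~ (W :\: gen v \subset side W) ->
    (gen v \subset W) && (W :\: gen v \subset W :\: side W).
  rewrite wE mesym1_le => /andP[vW vA]; have [v2p pv] := gen_perfect v.
  by have := two_cliques_gen_side E2 Wp sW vW v2p pv; rewrite vW (negbTE vA).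
by apply: (con _ _ _ sC); apply: cv.
Qed.

Lemma Phi_ker (s : 'rV[S]_#|gens|) : s *m gen_col = 0 ->
    (forall u m, m \in msupp (s 0 u) -> mdeg m = 2%N) ->
    (forall W, splits W -> Phi W s = 0) ->
  mker gen_col s.
Proof.
move=> sX s2 sPhi.
pose c w u := (s 0 u)@_(w - mesym1 (gen u)).
(* Decomposition into multigraded parts: entries of degree 2 put them all in total degree 2p+2, and
   the strict bound [(2 * p).+3] makes the index type finite. *)
have -> : s = \sum_(w : 'X_{1..n < (2 * p).+3} | mdeg w == (2 * p).+2)
    \sum_(u | (mesym1 (gen u) <= w)%MM) (c w u)%:MP *: elt w u.
  apply/rowP => u; rewrite summxE; apply/mpolyP => m; rewrite raddf_sum /=.
  have ent w : ((\sum_(u | (mesym1 (gen u) <= w)%MM) (c w u)%:MP *: elt w u) 0 u)@_m =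
      if (mesym1 (gen u) <= w)%MM && (w == m + mesym1 (gen u))%MM then c w u else 0.
    rewrite big_mkcond summxE (bigD1 u) //= big1 ?addr0 => [|v vu]; last first.
      by case: ifP; rewrite !mxE // eq_sym (negbTE vu) andbF mulr0 mulr0.
    case: (boolP (_ <= _)%MM) => uw; last by rewrite mxE mcoeff0.
    rewrite !mxE !eqxx mulr1 mcoeffCM mcoeffX.
    have -> : ((w - mesym1 (gen u))%MM == m) = (w == m + mesym1 (gen u))%MM.
      by apply/eqP/eqP => [<-|->]; rewrite ?submK ?addmK.
    by case: (w == _); rewrite ?mulr1 ?mulr0.
  under eq_bigr => w _ do rewrite ent.
  have [m2|m2] := eqVneq (mdeg m) 2%N; last first.
    rewrite big1 => [|w _].
      by apply: memN_msupp_eq0; apply: contraNN m2 => /s2 ->.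
    case: ifP => // /andP[_ /eqP->]; rewrite /c addmK.
    by apply: memN_msupp_eq0; apply: contraNN m2 => /s2 ->.
  have [u2p _] := gen_perfect u.
  have dm : mdeg (m + mesym1 (gen u)) = (2 * p).+2 by rewrite mdegD m2 mdeg_mesym1 u2p.
  have lt : (mdeg (m + mesym1 (gen u)) < (2 * p).+3)%N by rewrite dm.
  rewrite (bigD1 (BMultinom lt)) /=; last by rewrite dm.
  rewrite lem_addl eqxx /c addmK big1 ?addr0 // => w /andP[_ ne].
  case: ifP => // /andP[_ /eqP e]; case/eqP: ne; exact: val_inj.
apply: mker_sum => w /eqP wp; apply: multidegree_ker => // [|W gW wE].
  by rewrite -gen_mulE sX mxE mcoeff0.
by rewrite -[RHS](sPhi W gW); apply: eq_bigr => u _; rewrite /c wE mesym1B.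
Qed.
End Syzygies.

(** * The squarefree power as a monomial ideal *)

Section Ideals.
Variables (K : fieldType) (n : nat).
Local Notation S := {mpoly K[n]}.

Lemma ideal_gen_sub (G : S -> Prop) g : G g -> ideal_gen G g.
Proof.
by move=> Gg; exists 1%N, (fun=> 1), (fun=> g); split=> //; rewrite big_ord1 mul1r.
Qed.

Lemma ideal_gen_msupp (G : S -> Prop) f m : ideal_gen G f -> m \in msupp f ->
  exists2 g, G g & exists2 m', m' \in msupp g & (m' <= m)%MM.
Proof.
case=> r [c [g [Gg ->]]] /msupp_sum_le /flatten_mapP[k _ /msuppM_le].
case/allpairsP=> -[m1 m2] /= [_ m2g ->]; exists (g k) => //.
by exists m2 => //; apply: lem_addl.
Qed.

Lemma msupp_prod p (g : 'I_p -> S) m : m \in msupp (\prod_k g k) ->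
  exists2 h : 'I_p -> 'X_{1..n}, forall k, h k \in msupp (g k) & m = (\sum_k h k)%MM.
Proof.
elim: p g m => [|p IH] g m.
  by rewrite big_ord0 msupp1 inE => /eqP->; exists (fun=> 0%MM) => [[]//|]; rewrite big_ord0.
rewrite big_ord_recl => /msuppM_le /allpairsP[[m1 m2] /= [m1g /IH[h hg ->] ->]].
exists (fun k => if unlift ord0 k is Some j then h j else m1) => [k|].
  by case: unliftP => [j|] ->.
rewrite big_ord_recl unlift_none; congr (_ + _)%MM.
by apply: eq_bigr => j _; rewrite liftK.
Qed.

Lemma le_mdeg_eq (m m' : 'X_{1..n}) : (m' <= m)%MM -> (mdeg m <= mdeg m')%N -> m' = m.
Proof.
move=> le; rewrite -(mdeg_sub le) -[X in (_ <= X)%N]add0n leq_add2r leqn0 mdeg_eq0 => /eqP e.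
by rewrite -[RHS](submK le) e add0m.
Qed.

Variables (D : {set {set 'I_n}}).
Local Notation I := (@stanley_reisner n K D).
Local Notation E := (compl_edges D).

Lemma sr_msupp f m : I f -> m \in msupp f -> exists2 A, A \notin D & (mesym1 A <= m)%MM.
Proof.
move=> If /(ideal_gen_msupp If)[_ [A AD ->] [m' m'A m'm]]; exists A => //.
apply: lepm_trans m'm; move: m'A; rewrite mprodXE msuppX inE => /eqP->.
apply/mnm_lepP => i; rewrite mnm_mesym1E mnm_sumE.
case: (boolP (i \in A)) => // iA; rewrite (bigD1 i) //= mnm1E eqxx; exact: leq_addr.
Qed.

Lemma prodX_mesym1 (A : {set 'I_n}) : \prod_(i in A) 'X_i = 'X_[mesym1 A] :> S.
Proof.
rewrite mprodXE; congr 'X_[_]; apply/mnmP => i; rewrite mnm_mesym1E mnm_sumE.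
case: (boolP (i \in A)) => iA.
  rewrite (bigD1 i) //= mnm1E eqxx big1 // => j /andP[_ ji].
  by rewrite mnm1E (negbTE ji).
by rewrite big1 // => j jA; rewrite mnm1E; case: eqP iA => // <-; rewrite jA.
Qed.

Lemma sr_nonface (A : {set 'I_n}) : A \notin D -> I 'X_[mesym1 A].
Proof. by move=> AD; apply: ideal_gen_sub; exists A => //; rewrite prodX_mesym1. Qed.

Lemma compl_edge2 e : e \in E -> #|e| = 2%N.
Proof. by rewrite inE => /andP[/eqP]. Qed.

Hypothesis flagD : flag_complex K D.

(** Flagness makes x^A divisible by a degree-two monomial of an element of the ideal. It is
    squarefree, and its support contains a nonface, hence is one. *)
Lemma nonface_edge (A : {set 'I_n}) : A \notin D -> exists2 e, e \in E & e \subset A.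
Proof.
move=> /sr_nonface; case: flagD => [[_ downD] gen2] /gen2 IA.
have [|g [Ig g2] [m mg mA]] := ideal_gen_msupp IA (m := mesym1 A).
  by rewrite msuppX inE.
have m2 : mdeg m = 2%N by move/dhomogP: g2 => /(_ _ mg).
have [B BD Bm] := sr_msupp Ig mg.
have mE : m = mesym1 [set i | (0 < m i)%N].
  apply: mesym1_squarefree => i; apply: leq_trans (mnm_lepP mA i) _.
  by rewrite mnm_mesym1E; case: (i \in A).
rewrite mE !mesym1_le in Bm mA; exists [set i | (0 < m i)%N] => //.
rewrite inE -mdeg_mesym1 -mE m2 eqxx /=.
by apply: contraNN BD => /downD; apply.
Qed.

(** Three vertices are too many for a face, so they contain an edge of the complement. *)
Lemma flag_alpha2 : has_dim D 1 -> forall a b c, a != b -> a != c -> b != c ->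
  [|| [set a; b] \in E, [set a; c] \in E | [set b; c] \in E].
Proof.
case=> _ dim a b c ab ac bc.
have cA : #|[set c; a; b]| = 3.
  by rewrite -setUA cardsU1 cards2 ab !inE negb_or ![c == _]eq_sym ac bc.
have [|e eE eA] := @nonface_edge [set c; a; b].
  by apply/negP => /dim; rewrite cA.
have /eqP/cards2P[x [y [xy exy]]] := compl_edge2 eE.
rewrite exy in eA eE; move: eA; rewrite subUset !sub1set => /andP[xA yA].
have {}xA : [\/ x = c, x = a | x = b] by move: xA; rewrite !inE -orbA => /or3P[] /eqP; constructor.
have {}yA : [\/ y = c, y = a | y = b] by move: yA; rewrite !inE -orbA => /or3P[] /eqP; constructor.
case: xA yA xy eE => -> [] -> xy eE; rewrite ?eqxx // in xy;
  by rewrite ?eE ?orbT // setUC in eE *; rewrite eE ?orbT.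
Qed.

Lemma pow_msupp p f m : ideal_pow I p f -> m \in msupp f ->
  exists2 e : 'I_p -> {set 'I_n}, forall k, e k \in E & (\sum_k mesym1 (e k) <= m)%MM.
Proof.
move=> If /(ideal_gen_msupp If)[_ [g [Ig ->]] [m' /msupp_prod[h hg m'E] m'm]].
have /fin_all_exists2[e eE eh] : forall k, exists2 e, e \in E & (mesym1 e <= h k)%MM.
  move=> k; have [A AD Ah] := sr_msupp (Ig k) (hg k).
  have [e eE eA] := nonface_edge AD; exists e => //.
  by apply: lepm_trans Ah; rewrite mesym1_le.
exists e => //; apply: lepm_trans m'm; rewrite m'E; apply/mnm_lepP => i.
by rewrite !mnm_sumE; apply: leq_sum => k _; apply: (mnm_lepP (eh k)).
Qed.

Lemma pow_edges p (e : 'I_p -> {set 'I_n}) :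
  (forall k, e k \in E) -> ideal_pow I p 'X_[\sum_k mesym1 (e k)].
Proof.
move=> eE; apply: ideal_gen_sub; exists (fun k => 'X_[mesym1 (e k)]); split=> [k|].
  by apply: sr_nonface; have := eE k; rewrite inE => /andP[].
by rewrite mprodXE.
Qed.

Lemma mdeg_edges p (e : 'I_p -> {set 'I_n}) :
  (forall k, e k \in E) -> mdeg (\sum_k mesym1 (e k)) = (2 * p)%N.
Proof.
move=> eE; rewrite mdeg_sum (eq_bigr (fun=> 2%N)) => [|k _].
  by rewrite sum_nat_const card_ord mulnC.
by rewrite mdeg_mesym1 compl_edge2.
Qed.

(** A perfect matching writes x^V as a product of p edges; every monomial in the p-th power has
    degree at least 2p, so x^V is minimal. *)
Lemma gen_min_monomial p (V : {set 'I_n}) : V \in gens p E ->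
  min_monomial (ideal_pow I p) (mesym1 V).
Proof.
rewrite inE => /andP[/eqP V2p /perfectP[M ME MV]].
have M2p : (#|M| * 2 = 2 * p)%N.
  rewrite -V2p; apply/esym/card_uniform_partition => // e eM.
  by rewrite compl_edge2 // (subsetP ME).
have cM : #|M| = p by lia.
split.
  have -> : mesym1 V = (\sum_k mesym1 (enum_val (cast_ord (esym cM) k)))%MM.
    rewrite (reindex (cast_ord cM)) /=; last first.
      by exists (cast_ord (esym cM)) => k _; [apply: cast_ordK|apply: cast_ordKV].
    under [RHS]eq_bigr => k _ do rewrite cast_ordK.
    rewrite -(big_enum_val (fun e : {set 'I_n} => mesym1 e)) /=.
    apply/mnmP => i; rewrite mnm_mesym1E mnm_sumE -(cover_partition MV).
    case: (boolP (i \in cover M)) => [/bigcupP[e eM ie]|iM].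
      rewrite (bigD1 e) //= mnm_mesym1E ie big1 // => f /andP[fM fe].
      have /trivIsetP/(_ _ _ fM eM fe) := partition_trivIset MV.
      by rewrite disjoint_sym mnm_mesym1E => /disjointFr->.
    rewrite big1 // => e eM; rewrite mnm_mesym1E.
    by case: (boolP (i \in e)) => // ie; case/negP: iM; apply/bigcupP; exists e.
  by apply: pow_edges => k; apply: (subsetP ME); apply: enum_valP.
move=> m' m'V Im'; have [|e eE em'] := pow_msupp Im' (m := m'); first by rewrite msuppX inE.
by apply: le_mdeg_eq => //; rewrite mdeg_mesym1 V2p -(mdeg_edges eE) mdeg_le.
Qed.

(** By minimality [m] equals the product of p edges that divides it; a vertex on two of these edges
    would have exponent at least 2. *)
Lemma min_monomial_gen p m : min_monomial (ideal_pow I p) m -> squarefree_mnm m ->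
  exists2 V, V \in gens p E & m = mesym1 V.
Proof.
case=> Im minm sqm; exists [set i | (0 < m i)%N]; last exact: mesym1_squarefree.
set V := [set _ | _]; have mE : m = mesym1 V by apply: mesym1_squarefree.
have [|e eE em] := pow_msupp Im (m := m); first by rewrite msuppX inE.
have {}em := minm _ em (pow_edges eE).
have V2p : #|V| = (2 * p)%N by rewrite -mdeg_mesym1 -mE -em mdeg_edges.
rewrite inE V2p eqxx; apply/perfectP; exists [set e k | k : 'I_p].
  by apply/subsetP => _ /imsetP[k _ ->]; apply: eE.
have dis k k' i : i \in e k -> i \in e k' -> k = k'.
  move=> ik ik'; apply/eqP; apply: contraT => kk'; have := sqm i.
  rewrite -em mnm_sumE (bigD1 k) //= (bigD1 k') 1?eq_sym //= !mnm_mesym1E ik ik'.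
  by rewrite /= !add1n.
apply/and3P; split.
- apply/eqP/setP => i; rewrite inE -em mnm_sumE; apply/bigcupP/idP => [[_ /imsetP[k _ ->] ik]|].
    by rewrite (bigD1 k) //= mnm_mesym1E ik.
  rewrite lt0n sum_nat_eq0 negb_forall => /existsP[k]; rewrite mnm_mesym1E /= eqb0 negbK => ik.
  by exists (e k) => //; apply: imset_f.
- apply/trivIsetP => _ _ /imsetP[k _ ->] /imsetP[k' _ ->].
  apply: contraNT => /pred0Pn[i /= /andP[ik ik']].
  by rewrite (dis _ _ _ ik ik').
by apply/imsetP => -[k _ e0]; have := compl_edge2 (eE k); rewrite -e0 cards0.
Qed.

Lemma sqfree_power_gen p u : squarefree_power I p 'X_[mesym1 (gen (p := p) (E := E) u)].
Proof.
apply: ideal_gen_sub; exists (mesym1 (gen u)); split=> //.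
  by apply: gen_min_monomial; apply: enum_valP.
by move=> i; rewrite mnm_mesym1E leq_b1.
Qed.

Lemma sqfree_power_msupp p f m : squarefree_power I p f -> m \in msupp f ->
  exists u : 'I_#|gens p E|, (mesym1 (gen u) <= m)%MM.
Proof.
move=> If /(ideal_gen_msupp If)[_ [m0 [minm sqm ->]] [m']].
rewrite msuppX inE => /eqP-> le.
have [V gV m0E] := min_monomial_gen minm sqm.
by exists (enum_rank_in gV V); rewrite /gen enum_rankK_in // -m0E.
Qed.
End Ideals.

(** * Lifting polynomials to the free module on the generators *)

Section Lift.
Variables (K : fieldType) (n p : nat) (E : {set {set 'I_n}}).
Local Notation S := {mpoly K[n]}.
Local Notation X := (gen_col K p E).

Definition gen_below (m : 'X_{1..n}) : option 'I_#|gens p E| :=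
  [pick u | (mesym1 (gen u) <= m)%MM].

(** Each term of [f] is divided by the generator chosen by [gen_below]; a term divisible by no
    generator is dropped. *)
Definition lift_gen (f : S) : 'rV[S]_#|gens p E| :=
  \row_u \sum_(m <- msupp f | gen_below m == Some u) f@_m *: 'X_[m - mesym1 (gen u)].

Lemma gen_below_le m u : gen_below m = Some u -> (mesym1 (gen u) <= m)%MM.
Proof. by rewrite /gen_below; case: pickP => // v le [<-]. Qed.

Lemma lift_gen_mul f :
  (forall m, m \in msupp f -> exists u : 'I_#|gens p E|, (mesym1 (gen u) <= m)%MM) ->
  lift_gen f *m X = f%:M.
Proof.
move=> fI; apply/matrixP => i j; rewrite !ord1 !mxE mulr1n.
transitivity (\sum_u \sum_(m <- msupp f | gen_below m == Some u) f@_m *: 'X_[m] : S).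
  apply: eq_bigr => u _; rewrite !mxE mulr_suml; apply: eq_bigr => m /eqP/gen_below_le le.
  by rewrite -scalerAl -mpolyXD submK.
rewrite (exchange_big_dep xpredT) //= [RHS]mpolyE; apply: eq_big_seq => m /fI[u0 u0m].
have [u ->] : exists u, gen_below m = Some u.
  by rewrite /gen_below; case: pickP => [u _|/(_ u0)]; [exists u|rewrite u0m].
by rewrite (big_pred1 u) // => v; rewrite eq_sym.
Qed.

Lemma lift_gen_deg f u m : m \in msupp (lift_gen f 0 u) ->
  exists2 m', m' \in msupp f & mdeg m' = (mdeg m + 2 * p)%N.
Proof.
rewrite mxE => /msupp_sum_le /flatten_mapP[m']; rewrite mem_filter => /andP[/eqP/gen_below_le le m'f].
move=> /msuppZ_le; rewrite msuppX inE => /eqP->; exists m' => //.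
by rewrite -(mdeg_sub le) mdeg_mesym1; have [-> _] := gen_perfect u.
Qed.
End Lift.

Lemma mcoeff0_mulr (K : fieldType) n (f g : {mpoly K[n]}) :
  g@_0%MM = 0 -> (f * g)@_0%MM = 0.
Proof. by move=> g0; rewrite (rmorphM (mcoeff 0%MM)) /= g0 mulr0. Qed.

Lemma mcoeff0_mulmx (K : fieldType) n a b (v : 'rV[{mpoly K[n]}]_a) (B : 'M_(a, b)) l :
  (forall k, (B k l)@_0%MM = 0) -> ((v *m B) 0 l)@_0%MM = 0.
Proof. by move=> B0; rewrite mxE raddf_sum big1 // => k _; apply: mcoeff0_mulr. Qed.

(** All generators have degree 2p and are distinct, so only e_U contributes to the coefficient of
    x^U, and it contributes its constant term. *)
Lemma syzygy_min (K : fieldType) n p (E : {set {set 'I_n}}) (s : 'rV_#|gens p E|) u :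
  s *m gen_col K p E = 0 -> (s 0 u)@_0%MM = 0.
Proof.
move=> sX; have := gen_mulE s (mesym1 (gen u)).
rewrite sX mxE mcoeff0 (big_pred1 u) => [->|v]; first by rewrite mesym1B setDv mesym1_set0.
rewrite mesym1_le; apply/idP/eqP => [vu|-> //]; apply: gen_inj; apply/eqP.
have [up _] := gen_perfect u; have [vp _] := gen_perfect v.
by rewrite eqEcard vu up vp /=.
Qed.

(** * Minimal resolutions *)

Section Resolution.
Variables (K : fieldType) (n p : nat) (D : {set {set 'I_n}}).
Hypotheses (flagD : flag_complex K D) (dimD : has_dim D 1).
Variable F : free_complex n K.
Hypothesis resF :
  minimal_graded_free_resolution (squarefree_power (@stanley_reisner n K D) p) F.
Local Notation S := {mpoly K[n]}.
Local Notation E := (compl_edges D).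
Local Notation X := (gen_col K p E).
Local Notation aug := (fr_aug F).
Local Notation d0 := (fr_diff F 0).

Let E2 := @compl_edge2 n D.
Let alpha2 := flag_alpha2 flagD dimD.

Definition aug_lift : 'M[S]_(fr_rank F 0, #|gens p E|) :=
  \matrix_(k, u) lift_gen p E (aug k 0) 0 u.

Lemma lift_aug : aug_lift *m X = aug.
Proof.
have [_ [resI _ _] _] := resF.
apply/row_matrixP => k; rewrite row_mul.
have -> : row k aug_lift = lift_gen p E (aug k 0) by apply/rowP => u; rewrite !mxE.
rewrite lift_gen_mul => [|m]; first by apply/rowP => j; rewrite !ord1 !mxE mulr1n.
apply: (sqfree_power_msupp flagD); apply/resI; exists (delta_mx 0 k).
by rewrite -rowE mxE.
Qed.

Lemma gen_colift : exists beta, beta *m aug = X.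
Proof.
have [_ [resI _ _] _] := resF.
have /fin_all_exists[v vE] : forall u : 'I_#|gens p E|, exists v : 'rV_(fr_rank F 0),
    (v *m aug) 0 0 = 'X_[mesym1 (gen u)].
  by move=> u; apply/resI; apply: sqfree_power_gen.
exists (\matrix_u v u); apply/row_matrixP => u; rewrite row_mul rowK.
by apply/rowP => j; rewrite !ord1 vE !mxE.
Qed.

Lemma diff_aug : d0 *m aug = 0.
Proof.
have [_ [_ res0 _] _] := resF.
apply/row_matrixP => k; rewrite row_mul row0; apply/res0.
by exists (delta_mx 0 k); rewrite rowE.
Qed.

Lemma aug_ker c (Z : 'M_(c, fr_rank F 0)) : Z *m aug = 0 -> exists Y, Z = Y *m d0.
Proof.
have [_ [_ res0 _] _] := resF => Z0.
have /fin_all_exists[y yE] : forall k, exists w, row k Z = w *m d0.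
  by move=> k; apply/res0; rewrite -row_mul Z0 row0.
by exists (\matrix_k y k); apply/row_matrixP => k; rewrite row_mul rowK.
Qed.

(** The differential and the augmentation are graded, and dividing by a generator lowers degrees by
    2p. *)
Lemma syzygy_deg k u m : m \in msupp ((row k d0 *m aug_lift) 0 u) ->
  (mdeg m + 2 * p = fr_shift k)%N.
Proof.
have [[gaug gdiff] _ _] := resF.
rewrite mxE => /msupp_sum_le /flatten_mapP[l _ /msuppM_le /allpairsP[[m1 m2] /= []]].
rewrite [row k d0 _ _]mxE [aug_lift _ _]mxE => /gdiff <- /lift_gen_deg[m' /gaug <- ->] ->.
by rewrite mdegD addnA.
Qed.

Lemma Phi_syzygy0 W k : splits p E W -> fr_shift k != (2 * p).+2 ->
  Phi W (row k d0 *m aug_lift) = 0.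
Proof.
move=> /sideP[Wp _] kp; rewrite /Phi big1 // => u /andP[uW _].
apply: memN_msupp_eq0; apply: contraNN kp => /syzygy_deg <-.
have [up _] := gen_perfect u.
by rewrite mdeg_mesym1 cardsDS // Wp up -add2n addnK.
Qed.

(* Only the constant terms of [v] contribute, by [Phi_mker]. *)
Lemma Phi_diff W (v : 'rV_(fr_rank F 1)) : splits p E W ->
  Phi W (v *m d0 *m aug_lift) = \sum_k (v 0 k)@_0%MM * Phi W (row k d0 *m aug_lift).
Proof.
move=> sW; pose c : 'rV[S]_(fr_rank F 1) := \row_k ((v 0 k)@_0%MM)%:MP.
rewrite -[v in LHS](subrK c) -mulmxA mulmxDl PhiD Phi_mker // => [|]; last first.
  apply: mker_mulmx => [k|]; last by rewrite -mulmxA lift_aug diff_aug.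
  by rewrite !mxE mcoeffB mcoeffC eqxx mulr1 subrr.
rewrite add0r mulmx_sum_row Phi_sum; apply: eq_bigr => k _.
by rewrite mxE PhiZ row_mul.
Qed.

Definition top_rows := [set k : 'I_(fr_rank F 1) | fr_shift k == (2 * p).+2].

(** The pairing of the basis of F_1 in degree 2p+2 with the functionals [Phi]; its invertibility
    identifies the Betti number with the number of good sets. *)
Definition top_mx : 'M[K]_(#|top_rows|, #|good p D|) :=
  \matrix_(i, j) Phi (enum_val j) (row (enum_val i) d0 *m aug_lift).

Lemma splits_enum (j : 'I_#|good p D|) : splits p E (enum_val j).
Proof. by have := enum_valP j; rewrite inE. Qed.

(** A combination killed by every [Phi] maps into (x_1, ..., x_n) Syz. Transported back to F_0 it
    lies in (x_1, ..., x_n) times the image of [d0]; exactness and minimality then leave it no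
    constant coefficients. *)
Lemma top_mx_free : row_free top_mx.
Proof.
have [_ [_ _ res1] minF] := resF.
apply: inj_row_free => c cA.
pose C : 'rV[S]_(fr_rank F 1) := \sum_i (c 0 i)%:MP *: delta_mx 0 (enum_val i).
pose s := C *m d0 *m aug_lift.
have sE : s = \sum_i (c 0 i)%:MP *: (row (enum_val i) d0 *m aug_lift).
  rewrite /s /C -mulmxA mulmx_suml; apply: eq_bigr => i _.
  by rewrite -scalemxAl rowE mulmxA.
have sX : s *m X = 0 by rewrite /s -mulmxA lift_aug -mulmxA diff_aug mulmx0.
have ms : mker X s.
  apply: (Phi_ker E2 alpha2) => // [u m|W sW].
    rewrite sE summxE => /msupp_sum_le /flatten_mapP[i _].
    rewrite mxE mul_mpolyC => /msuppZ_le /syzygy_deg.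
    by have := enum_valP i; rewrite inE => /eqP->; lia.
  have gW : W \in good p D by rewrite inE.
  have e : (c *m top_mx) 0 (enum_rank_in gW W) = 0 by rewrite cA mxE.
  rewrite mxE in e; rewrite sE Phi_sum -[RHS]e; apply: eq_bigr => i _.
  by rewrite PhiZ mxE enum_rankK_in.
have [beta betaE] := gen_colift.
(* The round trip from F_0 through P is the identity up to a map factoring through [d0]. By
   minimality [C *m d0] has no constant terms, so this correction is harmless. *)
have [|Y YE] := @aug_ker _ (1%:M - aug_lift *m beta).
  by rewrite mulmxBl mul1mx -mulmxA betaE lift_aug subrr.
have CE : C *m d0 = s *m beta + C *m d0 *m (Y *m d0).
  by rewrite -YE mulmxBr mulmx1 /s -!mulmxA addrC subrK.
have mC : mker aug (C *m d0).
  rewrite CE; apply: mkerD; first exact: mker_trans (esym betaE) ms.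
  apply: mker_mulmx => [k|]; last by rewrite -mulmxA diff_aug mulmx0.
  by apply: mcoeff0_mulmx => l; apply: minF.
have [z zaug Cz] := mC.
have /fin_all_exists[w wE] : forall i, exists w, z i = w *m d0.
  by move=> i; apply: aug_ker.
(* Modulo the maximal ideal, [C] is thus a boundary, whose constant terms vanish by minimality;
   those of [C] are the entries of [c]. *)
have /res1[w' Cw] : (C - \sum_i 'X_i *: w i) *m d0 = 0.
  rewrite mulmxBl Cz mulmx_suml -sumrB big1 // => i _.
  by rewrite wE -scalemxAl subrr.
apply/rowP => i; rewrite mxE.
have : (C 0 (enum_val i))@_0%MM = 0.
  rewrite -[C](subrK (\sum_i 'X_i *: w i)) Cw mxE mcoeffD.
  rewrite mcoeff0_mulmx => [|k]; last exact: minF.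
  rewrite add0r summxE raddf_sum big1 // => j _.
  by rewrite /= mxE mulrC mcoeff0_mulr // mcoeffX mnm1_eq0.
rewrite /C summxE raddf_sum (bigD1 i) //= big1 => [|j ji]; last first.
  by rewrite /= !mxE (inj_eq enum_val_inj) eq_sym (negbTE ji) andbF mulr0 mcoeff0.
by rewrite !mxE !eqxx mulr1 mcoeffC eqxx mulr1 addr0.
Qed.

(** The dual syzygies of [Phi_surj] are pulled back to F_1. The round trip from P through F_0
    changes a syzygy only by an element of (x_1, ..., x_n) Syz, as syzygies have no constant terms,
    so the values of [Phi] survive. *)
Lemma top_mx_full : row_full top_mx.
Proof.
have [beta betaE] := gen_colift.
have /fin_all_exists[w wE] : forall j : 'I_#|good p D|, exists w : 'rV_(fr_rank F 1),
    forall W, splits p E W -> Phi W (w *m d0 *m aug_lift) = (W == enum_val j)%:R.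
  move=> j; have [s sX sW] := Phi_surj K E2 (splits_enum j).
  have [|w wE] := @aug_ker _ (s *m beta); first by rewrite -mulmxA betaE.
  exists w => W splW; rewrite -wE -sW.
  rewrite -[in RHS](subrK (s *m beta *m aug_lift) s) PhiD.
  rewrite [X in X + _]Phi_mker ?add0r //.
  have -> : s - s *m beta *m aug_lift = s *m (1%:M - beta *m aug_lift).
    by rewrite mulmxBr mulmx1 mulmxA.
  apply: mker_mulmx => [k|]; first exact: syzygy_min sX.
  by rewrite mulmxBl mul1mx -mulmxA lift_aug betaE subrr.
(* The left inverse consists of the constant terms of the [w j] in the rows of degree 2p+2; by
   [Phi_diff] and [Phi_syzygy0] nothing else contributes. *)
apply/row_fullP; exists (\matrix_(j, i) (w j 0 (enum_val i))@_0%MM).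
apply/matrixP => j j'; rewrite !mxE.
transitivity (Phi (enum_val j') (w j *m d0 *m aug_lift)).
  rewrite Phi_diff ?splits_enum //.
  rewrite (bigID (mem top_rows)) /= [X in _ = _ + X]big1 ?addr0 => [|k]; last first.
    by rewrite inE => kp; rewrite Phi_syzygy0 ?mulr0 ?splits_enum.
  rewrite [RHS]big_enum_val; apply: eq_bigr => i _.
  by rewrite !mxE.
by rewrite wE ?splits_enum // (inj_eq enum_val_inj) eq_sym.
Qed.

Lemma card_top_rows : #|top_rows| = #|good p D|.
Proof. by rewrite -(eqP top_mx_free) (eqP top_mx_full). Qed.
End Resolution.

Theorem theorem0p3 (K : fieldType) (n : nat) (D : {set {set 'I_n}})
    (flagD : flag_complex K D) (dimD : has_dim D 1)
    (p : nat) (p_ge2 : (2 <= p)%N)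
    (p_le_nu : (p <= matching_number (compl_edges D))%N)
    (F : free_complex n K)
    (resF : minimal_graded_free_resolution
              (squarefree_power (@stanley_reisner n K D) p) F) :
  graded_betti F 1 (2 * p + 2) =
    (\sum_(0 <= i < p | ~~ odd i)
       nb_induced D (@complete_bipartite (2 + i) (2 * p - i)))%N.
Proof. by rewrite -card_good -(card_top_rows flagD dimD resF) /graded_betti addn2. Qed.
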